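(* Let the $2\times2$ twist matrix $K$ be invertible and not proportional to the identity, with eigenvalues $\mathsf k_1,\mathsf k_2$. For almost any choice of the co-vector $\langle S|\in\mathcal H^*$ and of the inhomogeneities $\{\xi_1,\dots,\xi_N\}$ satisfying, for $i\ne j$, $\xi_i-\xi_j\notin\eta\mathbb{Z}$ and $\xi_i^{(0)}-\xi_j^{(0)}\notin\eta\mathbb{Z}$, the set of co-vectors $$\langle h_1,\dots,h_N|=\langle S|\prod_{n=1}^N\frac{\mathsf k_2^{h_n-2s_n}\,\mathsf T^{(K|2s_n-h_n)}(\xi_n^{(2s_n)})}{\prod_{k=0}^{2s_n-h_n-1}d(\xi_n^{(2s_n-k)})},\qquad h_n\in\{0,\dots,2s_n\},$$ is a basis of $\mathcal H^*$. Moreover, denoting by $\langle O|=\langle0,\dots,0|$ the co-vector of this set with all $h_n=0$, one also has $$\langle h_1,\dots,h_N|=\langle O|\prod_{n=1}^N\frac{\mathsf T^{(K|h_n)}(\xi_n^{(h_n-1)})}{\mathsf k_1^{h_n}\prod_{k=0}^{h_n-1}a(\xi_n^{(k)})},\qquad h_n\in\{0,\dots,2s_n\}.$$ Furthermore: a) if $K_{12}\ne0$ and one fixes $\langle S|=\langle h_1=2s_1,\dots,h_N=2s_N|_{Sk}$ (which also means $\langle O|=\langle0|$), then the basis coincides with Sklyanin's type basis: $\langle h_1,\dots,h_N|_{Sk}=\langle h_1,\dots,h_N|$ for all $h_n\in\{0,\dots,2s_n\}$, $n\in\{1,\dots,N\}$; b) if $K_{12}=0$ and one fixes $\langle S|=\underline{\langle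 h_1=2s_1,\dots,h_N=2s_N|}_{Sk}$, then $\underline{\langle h_1,\dots,h_N|}_{Sk}=\langle h_1,\dots,h_N|$ for all $h_n\in\{0,\dots,2s_n\}$, $n\in\{1,\dots,N\}$.
   Context: Setting. Let $\eta\in\mathbb{C}\setminus\{0\}$, $N\ge1$, and let $s_1,\dots,s_N$ be spins with $2s_n\in\mathbb{Z}_{>0}$. Let $V_n=\mathbb{C}^{2s_n+1}$ and $\mathcal H=\bigotimes_{n=1}^N V_n$. On $V_n$ let $S_n^z=\mathrm{diag}(s_n,s_n-1,\dots,-s_n)$, let $S_n^+$ be the matrix with only nonzero entries $(S_n^+)_{j,j+1}=\sqrt{j(2s_n+1-j)}$, $1\le j\le 2s_n$, and let $S_n^-=(S_n^+)^t$. With auxiliary space $V_0=\mathbb{C}^2$, the Lax operator is $$\mathsf L_{0n}(\lambda)=\begin{pmatrix}\lambda+\eta(\tfrac12+S_n^z)&\eta S_n^-\\ \eta S_n^+&\lambda+\eta(\tfrac12-S_n^z)\end{pmatrix}_{[0]}.$$ For a $2\times2$ matrix $K=(K_{ij})$ and inhomogeneities $\xi_1,\dots,\xi_N\in\mathbb{C}$, the monodromy matrix is $$\mathsf M_0^{(K)}(\lambda)=K_0\mathsf L_{0N}(\lambda-\xi_N)\cdots\mathsf L_{01}(\lambda-\xi_1)=\begin{pmatrix}\mathsf A^{(K)}(\lambda)&\mathsf B^{(K)}(\lambda)\\\mathsf C^{(K)}(\lambda)&\mathsf D^{(K)}(\lambda)\end{pmatrix}_{[0]}$$ and the transfer matrix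 is $\mathsf T^{(K)}(\lambda)=\mathsf T^{(K|1)}(\lambda)=\mathrm{tr}_0\mathsf M_0^{(K)}(\lambda)$. Fused transfer matrices. For $l\ge1$, let $P^+_{1\dots l}$ be the projector onto symmetric tensors in $(\mathbb{C}^2)^{\otimes l}$, with image $V^+_{1\dots l}$. Set $\mathsf T^{(K|l)}(\lambda)=\mathrm{tr}_{V^+_{1\dots l}}\big[P^+_{1\dots l}\mathsf M^{(K)}_1(\lambda+(l-1)\eta)\cdots\mathsf M^{(K)}_{l-1}(\lambda+\eta)\mathsf M^{(K)}_l(\lambda)P^+_{1\dots l}\big]$ and $\mathsf T^{(K|0)}(\lambda)=1$. All these operators commute with each other. Notation. $\xi_n^{(k)}=\xi_n-\tfrac\eta2+(s_n-k)\eta$, $a(\lambda)=\prod_{n=1}^N(\lambda-\xi_n^{(2s_n)})$, $d(\lambda)=\prod_{n=1}^N(\lambda-\xi_n^{(0)})$. Co-vectors are acted upon from the right. ''Almost any'' means outside the zero set of some nonzero polynomial. Sklyanin's type bases. Let $\langle0|=\bigotimes_n(1,0,\dots,0)\in\mathcal H^*$. If $K_{12}\neq0$, $$\langle h_1,\dots,h_N|_{Sk}=\langle0|\prod_{n=1}^N\prod_{k=0}^{h_n-1}\frac{\mathsf A^{(K)}(\xi_n^{(k)})}{\mathsf k_1a(\xi_n^{(k)})}.$$ If $K_{12}=0$, choose an invertible $2\times2$ matrix $W$ such that $\bar K=W^{-1}KW$ has $\bar K_{12}\ne0$ and $\bar K_{21}\neq0$. Let $\mathcal W=\bigotimes_nW_n^{(2s_n)}$,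 where $W_n^{(2s_n)}$ is the action of $W^{\otimes2s_n}$ on $\mathrm{Sym}^{2s_n}(\mathbb{C}^2)$ identified with $V_n$ as the spin-$s_n$ representation (the $j$-th basis vector of $V_n$ corresponds to the normalized symmetric tensor with $2s_n+1-j$ factors $e_1$ and $j-1$ factors $e_2$). Then $$\underline{\langle h_1,\dots,h_N|}_{Sk}=\langle0|\prod_{n=1}^N\prod_{k=0}^{h_n-1}\frac{\mathsf A^{(\bar K)}(\xi_n^{(k)})}{\mathsf k_1a(\xi_n^{(k)})}\,\mathcal W^{-1}.$$ *)

(* Defs.v *)
From mathcomp Require Import all_boot all_order all_algebra all_fingroup.

Set Implicit Arguments.
Unset Strict Implicit.
Unset Printing Implicit Defensive.

Import GRing.Theory Num.Theory.
Local Open Scope ring_scope.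

Section LocalOperators.

Variable C : numClosedFieldType.

(* A spin s is represented by the natural number m = 2s, and basis vectors are
   numbered from 0, so that j below is the 1-based index minus one. *)
Definition spin_z (m : nat) : 'M[C]_m.+1 :=
  diag_mx (\row_(j < m.+1) (m%:R / 2 - j%:R)).

Definition spin_plus (m : nat) : 'M[C]_m.+1 :=
  \matrix_(i, j) (if j == i.+1 :> nat then sqrtC (i.+1 * (m - i))%:R else 0).

Definition spin_minus (m : nat) : 'M[C]_m.+1 := (spin_plus m)^T.

Definition mx2 (T : Type) (a b c d : T) : 'M[T]_2 :=
  \matrix_(i, j) (if i == 0 then (if j == 0 then a else b)
                  else (if j == 0 then c else d)).

(* Basis of (C^2)^{\otimes l}: w stands for e_{w 0} \otimes ... \otimes
   e_{w (l-1)}, where the letters 0 and 1 stand for e_1 and e_2. *)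
Definition word (l : nat) := {ffun 'I_l -> 'I_2}.

Definition tensor_power (l : nat) (W : 'M[C]_2) : 'M[C]_#|{: word l}| :=
  \matrix_(i, j) \prod_(k < l)
    W ((enum_val i : word l) k) ((enum_val j : word l) k).

(* Average of the l! permutation operators. *)
Definition sym_proj (l : nat) : 'M[C]_#|{: word l}| :=
  \matrix_(i, j)
    ((l`!)%:R^-1 *
     \sum_(s : 'S_l)
       (enum_val j == [ffun k => (enum_val i : word l) (s k)])%:R).

(* Column j is the normalized symmetric tensor with l - j factors e_1 and j
   factors e_2: the sum of the 'C(l, j) words with j letters 1, over the square
   root of their number. *)
Definition sym_basis (l : nat) : 'M[C]_(#|{: word l}|, l.+1) :=
  \matrix_(i, j) (if #|[set k | (enum_val i : word l) k == 1]| == j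
                  then (sqrtC 'C(l, j)%:R)^-1 else 0).

(* sym_basis has orthonormal real columns, so that its transpose reads off the
   coordinates in the basis of symmetric tensors. *)
Definition spin_rep (m : nat) (W : 'M[C]_2) : 'M[C]_m.+1 :=
  (sym_basis m)^T *m tensor_power m W *m sym_basis m.

End LocalOperators.

Arguments sym_proj {C} l.
Arguments sym_basis {C} l.
Arguments spin_z {C} m.
Arguments spin_plus {C} m.
Arguments spin_minus {C} m.

Section Chain.

Variables (C : numClosedFieldType) (N : nat) (tws : 'I_N -> nat).

(* tws n is the integer 2 s_n. The same type indexes the basis of H and the
   labels (h_1, ..., h_N). *)
Definition config := {dffun forall n : 'I_N, 'I_(tws n).+1}.

Local Notation D := #|{: config}|.
Local Notation opH := 'M[C]_D.
Local Notation covec := 'rV[C]_D.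

Definition tensor_op (X : forall n : 'I_N, 'M[C]_((tws n).+1)) : opH :=
  \matrix_(i, j) \prod_(n < N)
    X n ((enum_val i : config) n) ((enum_val j : config) n).

Definition site (n : 'I_N) (X : 'M[C]_((tws n).+1)) : opH :=
  tensor_op
    (@dfwith _ (fun k : 'I_N => 'M[C]_((tws k).+1)) (fun=> 1%:M) n X).

Definition config0 : config := [ffun n => ord0].
Definition config_max : config := [ffun n => ord_max].

Definition bra0 : covec := \row_j ((enum_val j : config) == config0)%:R.

Variables (eta : C) (xi : 'I_N -> C).

(* An operator on C^2 \otimes H is a 2 x 2 matrix of operators on H. *)
Definition lax (n : 'I_N) (lam : C) : 'M[opH]_2 :=
  mx2 (site (lam%:M + eta *: ((2^-1)%:M + spin_z (tws n))))
      (site (eta *: spin_minus (tws n)))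
      (site (eta *: spin_plus (tws n)))
      (site (lam%:M + eta *: ((2^-1)%:M - spin_z (tws n)))).

Definition lift_op (p q : nat) (X : 'M[C]_(p, q)) : 'M[opH]_(p, q) :=
  map_mx scalar_mx X.

(* The Lax operators are multiplied in decreasing order of the site. *)
Definition monodromy (K : 'M[C]_2) (lam : C) : 'M[opH]_2 :=
  lift_op K *m
  \prod_(n < N) lax (rev_ord n) (lam - xi (rev_ord n)).

Definition opA (K : 'M[C]_2) (lam : C) : opH := monodromy K lam 0 0.

(* M_1(lam + (l-1) eta) ... M_l(lam), on (C^2)^{\otimes l} \otimes H. *)
Definition monodromies (K : 'M[C]_2) (l : nat) (lam : C) :
    'M[opH]_#|{: word l}| :=
  \matrix_(i, j) \prod_(k < l)
    monodromy K (lam + (l.-1 - k)%:R * eta)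
      ((enum_val i : word l) k) ((enum_val j : word l) k).

(* The trace is taken in the orthonormal basis sym_basis of the symmetric
   tensors. *)
Definition trace_sym (l : nat) (X : 'M[opH]_#|{: word l}|) : opH :=
  \tr (lift_op (sym_basis l)^T *m X *m lift_op (sym_basis l)).

Definition transfer (K : 'M[C]_2) (l : nat) (lam : C) : opH :=
  if l is 0 then 1%:M
  else trace_sym
         (lift_op (sym_proj l) *m monodromies K l lam *m lift_op (sym_proj l)).

Definition xik (n : 'I_N) (k : nat) : C :=
  xi n - eta / 2 + ((tws n)%:R / 2 - k%:R) * eta.

Definition a_fun (lam : C) : C := \prod_(n < N) (lam - xik n (tws n)).
Definition d_fun (lam : C) : C := \prod_(n < N) (lam - xik n 0).

Definition admissible : Prop :=
  forall i j : 'I_N, i != j -> forall z : int,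
    xi i - xi j != eta *~ z /\ xik i 0 - xik j 0 != eta *~ z.

(* The exponent h_n - 2s_n is a nonpositive integer, hence the computation in
   int. The factors of the product commute, as do those of the products below. *)
Definition sov (K : 'M[C]_2) (k2 : C) (S : covec) (h : config) : covec :=
  S *m \prod_(n < N)
    ((k2 ^ ((h n)%:Z - (tws n)%:Z) /
        \prod_(k < tws n - h n) d_fun (xik n (tws n - k))) *:
     transfer K (tws n - h n) (xik n (tws n))).

(* The exponent h_n - 1 in xi_n^{(h_n - 1)} is written h_n.-1: for h_n = 0 the
   spectral parameter is irrelevant since the transfer matrix is 1. *)
Definition sov_from_origin (K : 'M[C]_2) (k1 : C) (O : covec) (h : config) :
    covec :=
  O *m \prod_(n < N)
    ((k1 ^+ h n * \prod_(k < h n) a_fun (xik n k))^-1 *: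
     transfer K (h n) (xik n (h n).-1)).

Definition sklyanin (K : 'M[C]_2) (k1 : C) (h : config) : covec :=
  bra0 *m \prod_(n < N) \prod_(k < h n)
    ((k1 * a_fun (xik n k))^-1 *: opA K (xik n k)).

Definition sklyanin_rot (K W : 'M[C]_2) (k1 : C) (h : config) : covec :=
  sklyanin (invmx W *m K *m W) k1 h *m
  invmx (tensor_op (fun n => spin_rep (tws n) W)).

Definition is_covec_basis (v : config -> covec) : bool :=
  basis_of fullv [seq v h | h : config].

End Chain.

Arguments bra0 {C N tws}.
Arguments config0 {N tws}.
Arguments config_max {N tws}.

(* Main.v *)
(* By fusion, the transfer matrices T^(K|l) on a string of points are the
   continuants of the commuting operators T(x), T(x - eta), ... with the quantum
   determinants as subtracted weights. Euler's identity for continuants gives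
   T^(2s|xi^(2s)) T^(h|xi^(h-1)) = (product of quantum determinants) T^(2s-h|xi^(2s))
   at every site as soon as T^(2s+1|xi^(2s)) = 0, and this is exactly the relation
   between the two expressions of the basis.
   When K_12 is nonzero, the covectors <0| A(xi_n^(k)) ... are nonzero
   eigenvectors of B(mu) with pairwise distinct eigenvalues, hence a basis. One
   step too high on a site would give one more eigenvalue, so the covector
   vanishes there; as the covectors are also <0| times products of fused transfer
   matrices, T^(2s+1|xi^(2s)) kills a basis. The case K_12 = 0 follows by GL_2
   covariance. Genericity follows since the determinant of the numerators of the
   covectors is polynomial in (S, xi), and nonzero for Sklyanin's choice of S. *)
Require Import Defs.
From mathcomp Require Import all_boot all_order all_algebra all_fingroup.
From mathcomp Require Import reals complex mpoly.
From mathcomp Require Import ring zify.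

Set Implicit Arguments.
Unset Strict Implicit.
Unset Printing Implicit Defensive.

Import GRing.Theory Num.Theory.
Local Open Scope ring_scope.

(** * Tensor products of operators *)

(** At site n everything lives on the string xi_n^(0), ..., xi_n^(2s_n), and fused transfer matrices
    are continuants on windows of consecutive points. T^(h|xi^(h-1)) is the window of the first h
    points, T^(2s-h|xi^(2s)) that of the last 2s - h, and xi^(h) is the point left between them;
    T^(2s+1|xi^(2s)) is the whole string. The vanishing of the whole string is obtained from a
    dimension count, without fusing the quantum spaces. This needs covectors one step above the top
    of a string, hence labels in nat and covectors without the normalization 1/a(xi^(k)), as
    a(xi^(2s)) = 0. There is no circularity: writing these covectors with fused transfer matrices
    uses the recursion between them, not its closure. Since Sklyanin's covectors are shown to form a
    basis at admissible points, the genericity polynomial is proved nonzero by exhibiting one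
    admissible point. *)

Section TensorOperators.

Variables (C : numClosedFieldType) (N : nat) (tws : 'I_N -> nat).
Local Notation config := (config tws).
Local Notation locops := (forall n : 'I_N, 'M[C]_((tws n).+1)).

(** The range of [c n] depends on [n], so configurations are transported to [fprod], where each
    local sum becomes a sum over the pairs tagged by [n] and distributivity applies. *)
Lemma sum_config_prod (F : forall n : 'I_N, 'I_(tws n).+1 -> C) :
  \sum_(c : config) \prod_(n < N) F n (c n) = \prod_(n < N) \sum_j F n j.
Proof.
have [g gK g'K] := dffun_of_fprod_bij (fun n : 'I_N => 'I_(tws n).+1).
rewrite (reindex (@dffun_of_fprod _ (fun n : 'I_N => 'I_(tws n).+1))) /=;
  last by exists g => x _; [apply: gK | apply: g'K].
transitivity (\sum_(t : fprod (fun n : 'I_N => 'I_(tws n).+1))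
                \prod_(i in 'I_N) [ffun j => F i j] (t i)).
  by apply: eq_bigr => t _; apply: eq_bigr => i _; rewrite !ffunE.
rewrite (big_fprod 1 _ (fun i => [ffun j => F i j])).
rewrite -(bigA_distr_big_dep (fun i => tagged_with (fun n : 'I_N => 'I_(tws n).+1) i)
            (fun i g => untag 0 [ffun j => F i j] g)).
apply: eq_bigr => i _; rewrite -(big_tag (fun i j => [ffun j => F i j] j)).
by apply: eq_bigr => j _; rewrite ffunE.
Qed.

Lemma eq_tensor_op (X Y : locops) : (forall n, X n = Y n) -> tensor_op X = tensor_op Y.
Proof.
by move=> eXY; apply/matrixP=> i j; rewrite !mxE; apply: eq_bigr => n _; rewrite eXY.
Qed.

Lemma tensor_opM (X Y : locops) :
  tensor_op X *m tensor_op Y = tensor_op (fun n => X n *m Y n).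
Proof.
apply/matrixP=> i j; rewrite !mxE.
transitivity (\sum_(c : config) \prod_(n < N)
   (X n ((enum_val i : config) n) (c n) * Y n (c n) ((enum_val j : config) n))).
  rewrite [RHS]big_enum_val /=; apply: eq_bigr => k _.
  by rewrite !mxE -big_split.
rewrite (sum_config_prod (fun n c => X n ((enum_val i : config) n) c *
   Y n c ((enum_val j : config) n))).
by apply: eq_bigr => n _; rewrite mxE.
Qed.

Lemma tensor_op1 : tensor_op (fun n => 1%:M : 'M[C]_((tws n).+1)) = 1%:M.
Proof.
apply/matrixP=> i j; rewrite !mxE -(inj_eq enum_val_inj).
case: eqP => [->|neq]; first by rewrite big1 // => n _; rewrite mxE eqxx.
have /existsP [n nn] : [exists n, (enum_val i : config) n != (enum_val j : config) n].
  apply: contra_notT neq; rewrite negb_exists => /forallP eqn; apply/ffunP => n.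
  by move/negPn/eqP: (eqn n).
by rewrite (bigD1 n) //= mxE (negPf nn) mul0r.
Qed.

Lemma tensor_op_inv (X : locops) : (forall n, X n \in unitmx) ->
  tensor_op X \in unitmx.
Proof.
move=> Xu; apply: (proj1 (mulmx1_unit (B := tensor_op (fun n => invmx (X n))) _)).
by rewrite tensor_opM -tensor_op1; apply: eq_tensor_op => n; rewrite mulmxV.
Qed.

Section Site.
Variable n : 'I_N.
Implicit Types X Y : 'M[C]_((tws n).+1).

Lemma siteE X (i j : 'I_#|{: config}|) :
  site X i j = X ((enum_val i : config) n) ((enum_val j : config) n) *
    \prod_(m < N | m != n) (((enum_val i : config) m == (enum_val j : config) m)%:R).
Proof.
rewrite mxE (bigD1 n) //= dfwith_in; congr (_ * _).
apply: eq_bigr => m mn.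
by rewrite dfwith_out ?mxE // eq_sym.
Qed.

Lemma siteD X Y : site (X + Y) = site X + site Y.
Proof. by apply/matrixP=> i j; rewrite [RHS]mxE !siteE mxE mulrDl. Qed.

Lemma siteZ a X : site (a *: X) = a *: site X.
Proof. by apply/matrixP=> i j; rewrite [RHS]mxE !siteE mxE mulrA. Qed.

Lemma siteM X Y : site X *m site Y = site (X *m Y).
Proof.
rewrite tensor_opM; apply: eq_tensor_op => m.
have [->|mn] := eqVneq m n; first by rewrite !dfwith_in.
by rewrite !dfwith_out 1?eq_sym // mulmx1.
Qed.

Lemma site1 : site (1%:M : 'M[C]_((tws n).+1)) = 1%:M.
Proof.
rewrite -tensor_op1; apply: eq_tensor_op => m.
have [->|mn] := eqVneq m n; first by rewrite dfwith_in.
by rewrite dfwith_out // eq_sym.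
Qed.

Lemma site_scalar a : site (a%:M : 'M[C]_((tws n).+1)) = a%:M.
Proof. by rewrite -scalemx1 siteZ site1 scalemx1. Qed.

Lemma site_conj (W : locops) X Y : W n *m X = Y *m W n ->
  tensor_op W *m site X = site Y *m tensor_op W.
Proof.
move=> eWX; rewrite !tensor_opM; apply: eq_tensor_op => m.
have [->|mn] := eqVneq m n; first by rewrite !dfwith_in.
by rewrite !dfwith_out ?mulmx1 ?mul1mx // eq_sym.
Qed.

Lemma bra0_site X a : row ord0 X = a *: delta_mx 0 ord0 -> bra0 *m site X = a *: bra0.
Proof.
move=> rX; apply/rowP=> j.
have rXE k : X ord0 k = a * (k == ord0)%:R.
  by move/rowP/(_ k): rX; rewrite !mxE eqxx.
transitivity (\sum_(c : config) (c == @config0 N tws)%:R *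
    (X (c n) ((enum_val j : config) n) *
     \prod_(m < N | m != n) (c m == (enum_val j : config) m)%:R)).
  by rewrite big_enum_val mxE; apply: eq_bigr => k _; rewrite siteE !mxE.
rewrite (bigD1 (@config0 N tws)) //= eqxx mul1r [X in _ + X]big1; last first.
  by move=> c /negPf ->; rewrite mul0r.
rewrite addr0 !mxE !ffunE rXE -mulrA; congr (_ * _).
have [->|neq] := eqVneq (enum_val j) (@config0 N tws).
  by rewrite !ffunE !eqxx mul1r big1 // => m _; rewrite ffunE eqxx.
have [/eqP e0|] := boolP ((enum_val j : config) n == ord0); last by rewrite mul0r.
have /existsP [m mn] : [exists m, (enum_val j : config) m != ord0].
  apply: contraR neq; rewrite negb_exists => /forallP eqn; apply/eqP/ffunP => m.
  by rewrite ffunE; move/negPn/eqP: (eqn m).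
have mn' : m != n by apply: contraNneq mn => ->; rewrite e0.
rewrite (bigD1 m) //= ffunE eq_sym (negPf mn) mul0r mulr0 //.
Qed.

End Site.

Lemma site_comm (n m : 'I_N) (X : 'M[C]_((tws n).+1)) (Y : 'M[C]_((tws m).+1)) :
  n != m -> site X *m site Y = site Y *m site X.
Proof.
move=> nm; rewrite !tensor_opM; apply: eq_tensor_op => k.
have [->|kn] := eqVneq k n.
  by rewrite dfwith_in dfwith_out ?mulmx1 ?mul1mx // eq_sym.
rewrite (dfwith_out _ _ (i := n)) 1?eq_sym //.
by rewrite mulmx1 mul1mx.
Qed.

End TensorOperators.

(** * The Yang-Baxter relation and the quantum determinant *)

Section YangBaxter.

Variable A : pzRingType.
Implicit Types X Y : 'M[A]_2.

Definition central (a : A) := forall x, a * x = x * a.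

Definition entries_comm X Y := forall i j k l, X i j * Y k l = Y k l * X i j.

(* R(u) X_1 Y_2 = Y_2 X_1 R(u) with R(u) = u + eta P, entrywise. *)
Definition rtt (eta u : A) X Y := forall i j k l,
  u * (X i j * Y k l) + eta * (X k j * Y i l) =
  u * (Y k l * X i j) + eta * (Y k j * X i l).

(* X_1 Y_2 P^- = q P^-, where P^- projects onto antisymmetric tensors. *)
Definition qdet_rel X Y (q : A) := forall i k,
  X i 0 * Y k 1 - X i 1 * Y k 0 = (if i == k then 0 else if i == 0 then q else - q).

Lemma ord2_cases (a : 'I_2) : a = 0 \/ a = 1.
Proof. by case: a => [[|[|//]] ?]; [left | right]; apply: val_inj. Qed.

Lemma big_ord2 (V : nmodType) (F : 'I_2 -> V) : \sum_(i < 2) F i = F 0 + F 1.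
Proof. by rewrite !big_ord_recl big_ord0 addr0; congr (_ + F _); apply: val_inj. Qed.

(** Coproduct of the exchange algebra: commuting Y with X' groups the factors as (X_1 Y_2)(X'_1
    Y'_2), and R passes through the left pair, then through the right one. *)
Lemma rttM eta u X Y X' Y' : central eta -> central u ->
  rtt eta u X Y -> rtt eta u X' Y' ->
  entries_comm X Y' -> entries_comm Y X' ->
  rtt eta u (X *m X') (Y *m Y').
Proof.
move=> eC uC XY XY' cXY' cYX' i j k l; rewrite !mxE.
have E1 a i' j' k' l' (X0 Y0 X0' Y0' : 'M[A]_2) : entries_comm Y0 X0' ->
    a * ((\sum_p X0 i' p * X0' p j') * (\sum_p Y0 k' p * Y0' p l')) =
    \sum_p \sum_r (a * (X0 i' p * Y0 k' r)) * (X0' p j' * Y0' r l').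
  move=> c0; rewrite mulr_suml mulr_sumr; apply: eq_bigr => p _.
  rewrite mulr_sumr mulr_sumr; apply: eq_bigr => r _.
  by rewrite -!mulrA [X0' p j' * (_ * _)]mulrA -c0 !mulrA.
rewrite !E1 //; try by move=> *; rewrite ?cXY' ?cYX'.
rewrite -big_split /=.
transitivity (\sum_p \sum_r (u * (Y k r * X i p) + eta * (Y k p * X i r)) *
                (X' p j * Y' r l)).
  apply: eq_bigr => p _; rewrite -big_split; apply: eq_bigr => r _ /=.
  by rewrite -mulrDl XY.
transitivity (\sum_p \sum_r (Y k r * X i p) *
                (u * (X' p j * Y' r l) + eta * (X' r j * Y' p l))).
  under eq_bigr do (under eq_bigr do rewrite mulrDl; rewrite big_split).
  rewrite big_split [X in _ + X = _]exchange_big /= -big_split.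
  apply: eq_bigr => p _; rewrite -big_split; apply: eq_bigr => r _ /=.
  by rewrite eC uC mulrDr -!mulrA [u * (_ * _)]mulrA [eta * (_ * _)]mulrA uC eC !mulrA.
transitivity (\sum_p (\sum_r (Y k r * X i p) * (u * (Y' r l * X' p j)) +
                      \sum_r (Y k r * X i p) * (eta * (Y' r j * X' p l)))).
  apply: eq_bigr => p _; rewrite -big_split; apply: eq_bigr => r _ /=.
  by rewrite XY' mulrDr.
rewrite big_split exchange_big [X in _ + X = _]exchange_big /=.
congr (_ + _); apply: eq_bigr => p _; apply: eq_bigr => r _.
  by rewrite !mulrA -[_ * _ * u]uC !mulrA.
by rewrite !mulrA -[_ * _ * eta]eC !mulrA.
Qed.

Lemma rtt1 eta u : rtt eta u 1%:M 1%:M.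
Proof.
by move=> i j k l; rewrite !mxE -!natrM !mulnb [(i == j) && _]andbC.
Qed.

(** On antisymmetric tensors the pair X', Y' acts by q', and the pair X, Y then acts by q. *)
Lemma qdet_relM X Y X' Y' q q' : qdet_rel X Y q -> qdet_rel X' Y' q' ->
  entries_comm Y X' -> qdet_rel (X *m X') (Y *m Y') (q * q').
Proof.
move=> XY XY' c i k; rewrite !mxE.
have E1 j l : (\sum_p X i p * X' p j) * (\sum_p Y k p * Y' p l) =
    \sum_p \sum_r (X i p * Y k r) * (X' p j * Y' r l).
  rewrite mulr_suml; apply: eq_bigr => p _.
  rewrite mulr_sumr; apply: eq_bigr => r _.
  by rewrite -!mulrA [X' p j * (_ * _)]mulrA -c !mulrA.
rewrite !E1 -sumrB.
transitivity (\sum_p \sum_r (X i p * Y k r) *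
   (if p == r then 0 else if p == 0 then q' else - q')).
  apply: eq_bigr => p _; rewrite -sumrB; apply: eq_bigr => r _.
  by rewrite -mulrBr XY'.
rewrite !big_ord2 !eqxx /= !mulr0 addr0 add0r mulrN -mulrBl XY.
by case: ifP => _; rewrite ?mul0r //; case: ifP => _; rewrite ?mulNr.
Qed.

Lemma qdet_rel1 : qdet_rel 1%:M 1%:M 1.
Proof.
move=> i k; rewrite !mxE; case: (i =P 0) => [->|/eqP i0] /=.
  by rewrite mul0r subr0 mul1r eq_sym; case: k => [[|[|//]] ?].
have -> : i = 1 by case: i i0 => [[|[|//]] ?] // _; apply: val_inj.
by rewrite mul0r sub0r mul1r eq_sym; case: k => [[|[|//]] ?] //=; rewrite oppr0.
Qed.

Section Product.
Variables (I : eqType) (r : seq I) (r_uniq : uniq r) (X Y : I -> 'M[A]_2).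
Hypotheses (XY : forall n m, n != m -> entries_comm (X n) (Y m))
  (YX : forall n m, n != m -> entries_comm (Y n) (X m)).

Lemma entries_comm_prod (Z : 'M[A]_2) (s : seq I) (F : I -> 'M[A]_2) :
  (forall n, n \in s -> entries_comm Z (F n)) -> entries_comm Z (\prod_(n <- s) F n).
Proof.
elim: s => [|n s IH] c i j k l.
  by rewrite big_nil mxE; case: eqP => _; rewrite ?mulr1 ?mul1r ?mulr0 ?mul0r.
rewrite big_cons mxE mulr_sumr mulr_suml; apply: eq_bigr => p _.
rewrite -mulrA -IH => [|m ms]; last by apply: c; rewrite inE ms orbT.
by rewrite !mulrA c // mem_head.
Qed.

Lemma rtt_prod eta u : central eta -> central u ->
  (forall n, rtt eta u (X n) (Y n)) ->
  rtt eta u (\prod_(n <- r) X n) (\prod_(n <- r) Y n).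
Proof.
move=> eC uC H; elim: r r_uniq => [|n s IH] /=.
  by rewrite !big_nil => _; apply: rtt1.
case/andP=> ns us; rewrite !big_cons; apply: rttM => //; first exact: IH.
- by apply: entries_comm_prod => m ms; apply: XY; apply: contraNneq ns => ->.
- by apply: entries_comm_prod => m ms; apply: YX; apply: contraNneq ns => ->.
Qed.

Lemma qdet_rel_prod (q : I -> A) : (forall n, qdet_rel (X n) (Y n) (q n)) ->
  qdet_rel (\prod_(n <- r) X n) (\prod_(n <- r) Y n) (\prod_(n <- r) q n).
Proof.
move=> H; elim: r r_uniq => [|n s IH] /=.
  by rewrite !big_nil => _; apply: qdet_rel1.
case/andP=> ns us; rewrite !big_cons; apply: qdet_relM => //; first exact: IH.
by apply: entries_comm_prod => m ms; apply: YX; apply: contraNneq ns => ->.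
Qed.

End Product.

(** The two relations give two expressions of u [X_ii, Y_kk]. Summed over i and k they are opposite,
    up to exchanging i and k in one of them, so 2 u [tr X, tr Y] = 0. *)
Lemma rtt_trace_comm eta u X Y : central eta -> central u ->
  (forall x, u * x = 0 -> x = 0) -> (forall x : A, x *+ 2 = 0 -> x = 0) ->
  rtt eta u X Y -> rtt eta (- u) Y X -> \tr X * \tr Y = \tr Y * \tr X.
Proof.
move=> eC uC u0 two0 XY YX.
have aux (a b c d : A) : a + b = c + d -> a - c = d - b.
  by move=> E; apply/eqP; rewrite subr_eq addrAC [d + c]addrC -E addrK.
have H i k : u * (X i i * Y k k - Y k k * X i i) = eta * (Y k i * X i k - X k i * Y i k).
  by rewrite !mulrBr; apply: aux; apply: XY.
have H' i k : u * (X i i * Y k k - Y k k * X i i) = eta * (X i k * Y k i - Y i k * X k i).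
  by move/aux: (YX k k i i); rewrite !mulNr opprK addrC !mulrBr.
apply/eqP; rewrite -subr_eq0; apply/eqP; apply: u0; apply: two0.
have E : \tr X * \tr Y - \tr Y * \tr X =
    \sum_i \sum_k (X i i * Y k k - Y k k * X i i).
  rewrite /mxtrace !mulr_suml.
  rewrite [in RHS](eq_bigr _ (fun i _ => sumrB _ _ _ _)) sumrB; congr (_ - _).
    by apply: eq_bigr => i _; rewrite mulr_sumr.
  by rewrite exchange_big; apply: eq_bigr => i _; rewrite mulr_sumr.
have E1 : u * (\tr X * \tr Y - \tr Y * \tr X) =
    eta * \sum_i \sum_k (Y k i * X i k - X k i * Y i k).
  rewrite E !mulr_sumr; apply: eq_bigr => i _; rewrite !mulr_sumr.
  by apply: eq_bigr => k _.
have E2 : u * (\tr X * \tr Y - \tr Y * \tr X) =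
    eta * \sum_i \sum_k (X i k * Y k i - Y i k * X k i).
  rewrite E !mulr_sumr; apply: eq_bigr => i _; rewrite !mulr_sumr.
  by apply: eq_bigr => k _.
rewrite mulr2n {1}E1 E2 -mulrDr [X in X + _]exchange_big -big_split /= big1 ?mulr0 // => i _.
rewrite -big_split big1 // => k _ /=.
by rewrite addrC addrA subrK subrr.
Qed.

End YangBaxter.

(** * Spin matrices and Lax operators *)

Section SpinMatrices.

Variables (C : numClosedFieldType) (m : nat).
Local Notation Sz := (@spin_z C m).
Local Notation Sp := (@spin_plus C m).
Local Notation Sm := (@spin_minus C m).

Lemma spin_plus_minus :
  Sp *m Sm = diag_mx (\row_(i < m.+1) (i.+1 * (m - i))%:R).
Proof.
apply/matrixP=> i j; rewrite !mxE.
under eq_bigr do rewrite !mxE.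
have [im|im] := ltnP i m; last first.
  have -> : (m - i = 0)%N by apply/eqP; rewrite subn_eq0.
  rewrite muln0 mul0rn big1 // => k _.
  by case: eqP => [ki|]; rewrite ?mul0r //; have := ltn_ord k; rewrite ki ltnS leqNgt ltnS im.
rewrite (bigD1 (Ordinal (im : i.+1 < m.+1)%N)) //= eqxx eqSS big1 => [|k].
  case: (eqVneq i j) => [->|ij].
    by rewrite eqxx addr0 -expr2 sqrtCK mulr1n.
  by rewrite (negPf (ij : i != j :> nat)) mulr0 addr0 mulr0n.
by rewrite -val_eqE /= => /negPf ->; rewrite mul0r.
Qed.

Lemma spin_minus_plus :
  Sm *m Sp = diag_mx (\row_(i < m.+1) (i * (m - i.-1))%:R).
Proof.
apply/matrixP=> i j; rewrite !mxE.
under eq_bigr do rewrite !mxE.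
case: i => [[|i] im].
  rewrite mul0n mul0rn big1 // => k _.
  by rewrite mul0r.
have im' : (i < m.+1)%N by apply: ltnW.
rewrite (bigD1 (Ordinal im')) //= eqxx big1 => [|k].
  rewrite -val_eqE /= eq_sym; case: eqP => ij.
    by rewrite addr0 -expr2 sqrtCK mulr1n.
  by rewrite mulr0 addr0 mulr0n.
by rewrite -val_eqE /= eqSS eq_sym => /negPf ->; rewrite mul0r.
Qed.

Lemma spin_z_plus : Sz *m Sp = Sp *m Sz + Sp.
Proof.
apply/matrixP=> i j; rewrite mul_diag_mx mul_mx_diag !mxE.
case: eqP => [->|_]; last by rewrite !(mulr0, mul0r, addr0).
rewrite -[i.+1]addn1 natrD; ring.
Qed.

Lemma spin_z_minus : Sz *m Sm = Sm *m Sz - Sm.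
Proof.
apply: trmx_inj; rewrite raddfB /= !trmx_mul /spin_minus trmxK /spin_z tr_diag_mx.
by rewrite spin_z_plus addrK.
Qed.

Lemma spin_plus_minus_comm : Sp *m Sm = Sm *m Sp + 2 *: Sz.
Proof.
rewrite spin_plus_minus spin_minus_plus; apply/matrixP=> i j; rewrite !mxE.
case: eqP => _; rewrite ?mulr0n ?mulr1n; last by rewrite mulr0 addr0.
have im : (i <= m)%N by rewrite -ltnS.
case: (val i) im => [|k] km /=.
  rewrite mul0n mul1n subn0 mulrBr mulr0 subr0 mulrC divfK ?add0r //.
  by rewrite pnatr_eq0.
have -> : (m - k = (m - k.+1).+1)%N by lia.
rewrite mulrBr (mulrC 2) divfK ?pnatr_eq0 //.
have -> : m%:R = (m - k.+1)%:R + k.+1%:R :> C by rewrite -natrD; congr _%:R; lia.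
rewrite !natrM; move: (m - k.+1)%N => p.
by rewrite -(natr1 k.+1) -(natr1 p) -(natr1 k); ring.
Qed.

(* gl2_gen i j is the image of the matrix unit E_ji in the spin
   representation, up to a multiple of the identity when i = j. *)
Definition gl2_gen : 'M['M[C]_m.+1]_2 :=
  mx2 ((2^-1)%:M + Sz) Sm Sp ((2^-1)%:M - Sz).

Lemma gl2_gen_comm i j k l :
  gl2_gen i j *m gl2_gen k l - gl2_gen k l *m gl2_gen i j =
  (i == l)%:R *: gl2_gen k j - (k == j)%:R *: gl2_gen i l.
Proof.
case: (ord2_cases i) => ->; case: (ord2_cases j) => ->;
  case: (ord2_cases k) => ->; case: (ord2_cases l) => ->;
  rewrite !mxE /= ?scale0r ?scale1r ?subrr ?sub0r ?subr0 ?mulmxDl ?mulmxDr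
    ?mulmxN ?mulNmx ?scalar_mxC ?opprD ?spin_z_plus ?spin_z_minus
    ?spin_plus_minus_comm.
(* Products of spin matrices become atoms, in which the remaining identities are linear. *)
all: repeat match goal with |- context [?a *m ?b] =>
  let x := fresh in set x := a *m b; move: x => x end.
all: try move: (2^-1)%:M; try move: Sz; try move: Sp; try move: Sm; move=> *.
all: apply/matrixP=> p q; rewrite !mxE; ring.
Qed.

Definition local_lax (eta lam : C) : 'M['M[C]_m.+1]_2 :=
  \matrix_(i, j) (((i == j)%:R * lam)%:M + eta *: gl2_gen i j).

Lemma local_laxE eta lam i j :
  local_lax eta lam i j = ((i == j)%:R * lam)%:M + eta *: gl2_gen i j.
Proof. by rewrite [LHS]mxE. Qed.

(** With L = lam + eta E, where E is [gl2_gen], the terms of the relation that do not cancel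
    outright are the gl_2 commutation relations. *)
Lemma local_lax_rtt eta lam mu :
  rtt eta%:M (lam - mu)%:M (local_lax eta lam) (local_lax eta mu).
Proof.
move=> i j k l; rewrite !local_laxE.
have E a b (X Y : 'M[C]_m.+1) : (a%:M + eta *: X) * (b%:M + eta *: Y) =
    (a * b)%:M + (a * eta) *: Y + (eta * b) *: X + eta ^+ 2 *: (X *m Y).
  rewrite -mulmxE mulmxDl !mulmxDr !mul_scalar_mx -!scalemxAl mul_mx_scalar -scalemxAr.
  by rewrite !scalerA scale_scalar_mx expr2 addrA.
rewrite !E.
have /eqP := gl2_gen_comm i j k l; rewrite subr_eq => /eqP ->.
rewrite -!mulmxE !mul_scalar_mx; move: (gl2_gen k l *m _) => x.
move: (gl2_gen i j) (gl2_gen k l) (gl2_gen k j) (gl2_gen i l) => *.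
apply/matrixP=> p q.
have sE a : (a%:M : 'M[C]_m.+1) p q = a * (p == q)%:R by rewrite mxE mulr_natr.
rewrite !(sE, mxE); ring.
Qed.

(** At u = eta the R-matrix is eta (1 + P), so the exchange relation says that X_1 Y_2 P^- has no
    symmetric part. A single entry then determines the others; it is computed where S^- S^+ and S^z
    are diagonal. *)
Lemma local_lax_qdet eta lam : eta != 0 ->
  qdet_rel (local_lax eta lam) (local_lax eta (lam - eta))
    ((lam + (eta / 2 + (m%:R / 2) * eta)) * (lam - (eta / 2 + (m%:R / 2) * eta)))%:M.
Proof.
move=> eta0; set q := (X in qdet_rel _ _ X); have := local_lax_rtt eta lam (lam - eta).
set X := local_lax _ _; set Y := local_lax _ _.
rewrite opprB addrC subrK => XY.
have XYr i k : X i 0 * Y k 1 + X k 0 * Y i 1 = X i 1 * Y k 0 + X k 1 * Y i 0.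
  have := XY i 0 k 1; rewrite [RHS]addrC -(XY i 1 k 0) -!mulrDr -!mulmxE !mul_scalar_mx.
  by move/(scalerI eta0).
have two0 : (2 : C) != 0 by rewrite pnatr_eq0.
have XX i : X i 0 * Y i 1 = X i 1 * Y i 0.
  have := XYr i i; rewrite -!mulr2n -!scaler_nat.
  by move/(scalerI two0).
have q01 : X 0 0 * Y 1 1 - X 0 1 * Y 1 0 = q.
  rewrite -!mulmxE !mxE /= !mul1r !mul0r raddf0 !add0r -scalemxAl -scalemxAr spin_minus_plus.
  have -> : lam%:M + eta *: ((2^-1)%:M + Sz) =
      diag_mx (\row_(p < m.+1) (lam + eta * (2^-1 + (m%:R / 2 - p%:R)))).
    apply/matrixP=> p r; rewrite !mxE; case: eqP => _; rewrite ?mulr1n ?mulr0n //.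
    by rewrite addr0 mulr0 addr0.
  have -> : (lam - eta)%:M + eta *: ((2^-1)%:M - Sz) =
      diag_mx (\row_(p < m.+1) (lam - eta + eta * (2^-1 - (m%:R / 2 - p%:R)))).
    apply/matrixP=> p r; rewrite !mxE; case: eqP => _; rewrite ?mulr1n ?mulr0n //.
    by rewrite subr0 mulr0 addr0.
  rewrite mulmx_diag; apply/matrixP=> p r; rewrite !mxE; case: eqP => _;
    rewrite ?mulr1n ?mulr0n; last by rewrite !mulr0 subr0.
  have pm : (p <= m)%N by rewrite -ltnS.
  have -> : (p * (m - p.-1))%:R = p%:R * (m%:R - (p%:R - 1)) :> C.
    case: (val p) pm => [|k] km; first by rewrite mul0n mul0r.
    by rewrite natrM natrB ?(ltnW km) // -(natr1 k) addrK.
  by field.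
move=> i k; have [->|] := eqVneq i k; first by rewrite XX subrr.
case: (ord2_cases i) => ->; case: (ord2_cases k) => -> // _.
rewrite /= -q01 opprB; apply/eqP; rewrite subr_eq addrAC eq_sym subr_eq.
by rewrite -(XYr 0 1) [X in _ == X]addrC.
Qed.

End SpinMatrices.

(** * Monodromy matrices *)

Section Monodromy.

Variables (C : numClosedFieldType) (N : nat) (tws : 'I_N -> nat).
Variables (eta : C) (eta0 : eta != 0) (xi : 'I_N -> C).
Local Notation config := (config tws).
Local Notation opH := 'M[C]_#|{: config}|.
Local Notation mono := (@monodromy C N tws eta xi).
Local Notation afun := (@a_fun C N tws eta xi).
Local Notation dfun := (@d_fun C N tws eta xi).
Local Notation lax := (@lax C N tws eta).

Lemma laxE (n : 'I_N) lam i j :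
  lax n lam i j = site (local_lax (tws n) eta lam i j).
Proof.
rewrite local_laxE !mxE; case: i => [[|[|//]] ?]; case: j => [[|[|//]] ?] /=;
  by rewrite ?mul1r ?mul0r ?raddf0 ?add0r.
Qed.

Lemma lax_comm (n m : 'I_N) lam mu : n != m ->
  entries_comm (lax n lam) (lax m mu).
Proof. by move=> nm i j k l; rewrite !laxE -!mulmxE site_comm. Qed.

Lemma central_scalar n (a : C) : central (a%:M : 'M[C]_n).
Proof. by move=> x; rewrite -mulmxE scalar_mxC. Qed.

Lemma lift_comm (K : 'M[C]_2) (X : 'M[opH]_2) : entries_comm (lift_op tws K) X.
Proof. by move=> i j k l; rewrite !mxE central_scalar. Qed.

Lemma lax_rtt (n : 'I_N) lam mu :
  rtt eta%:M (lam - mu)%:M (lax n lam) (lax n mu).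
Proof.
move=> i j k l; rewrite !laxE -!mulmxE !siteM -!(@site_scalar C N tws n) !siteM -!siteD.
by congr (site _); rewrite !mulmxE local_lax_rtt.
Qed.

Lemma siteN (n : 'I_N) (X : 'M[C]_((tws n).+1)) : site (- X) = - site X.
Proof. by rewrite -scaleN1r siteZ scaleN1r. Qed.

Lemma site0 (n : 'I_N) : site (0 : 'M[C]_((tws n).+1)) = 0.
Proof. by rewrite -[0 in LHS](scale0r 1%:M) siteZ scale0r. Qed.

Lemma lax_qdet (n : 'I_N) lam :
  qdet_rel (lax n lam) (lax n (lam - eta))
    ((lam + (eta / 2 + ((tws n)%:R / 2) * eta)) *
     (lam - (eta / 2 + ((tws n)%:R / 2) * eta)))%:M.
Proof.
move=> i k; rewrite !laxE -!mulmxE !siteM -siteN -siteD !mulmxE local_lax_qdet //.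
by rewrite -(@site_scalar C N tws n) -siteN; case: ifP => _; [rewrite site0 | case: ifP].
Qed.

Lemma prod_scalar_mx n I (r : seq I) (F : I -> C) :
  \prod_(i <- r) ((F i)%:M : 'M[C]_n) = (\prod_(i <- r) F i)%:M.
Proof. by rewrite (big_morph _ (@scalar_mxM _ n) (erefl _)). Qed.

Lemma rtt_monodromy K lam mu :
  rtt eta%:M (lam - mu)%:M (mono K lam) (mono K mu).
Proof.
have rl (n m : 'I_N) x y : n != m ->
    entries_comm (lax (rev_ord n) x) (lax (rev_ord m) y).
  by move=> nm; apply: lax_comm; rewrite (inj_eq rev_ord_inj).
apply: rttM; try exact: central_scalar; try exact: lift_comm.
  move=> i j k l; rewrite !mxE; congr (_ * _ + _); exact: central_scalar.
apply: rtt_prod; rewrite ?index_enum_uniq //; try exact: central_scalar.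
- by move=> n m nm; apply: rl.
- by move=> n m nm; apply: rl.
move=> n; have -> : lam - mu = lam - xi (rev_ord n) - (mu - xi (rev_ord n)).
  by rewrite opprB addrA subrK.
exact: lax_rtt.
Qed.

Lemma det_mx22 (K : 'M[C]_2) : \det K = K 0 0 * K 1 1 - K 0 1 * K 1 0.
Proof.
rewrite (expand_det_row _ 0) big_ord2 /cofactor !det_mx11 !mxE /= expr0 expr1.
by rewrite mul1r mulN1r mulrN; congr (_ * K _ _ - _ * K _ _); apply: val_inj.
Qed.

(** The local factors are lam - xi_n^(2s_n) and lam - eta - xi_n^(0), which collect into a(lam) and
    d(lam - eta). *)
Lemma qdet_monodromy K lam :
  qdet_rel (mono K lam) (mono K (lam - eta))
    (\det K * (afun lam * dfun (lam - eta)))%:M.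
Proof.
have rl (n m : 'I_N) x y : n != m ->
    entries_comm (lax (rev_ord n) x) (lax (rev_ord m) y).
  by move=> nm; apply: lax_comm; rewrite (inj_eq rev_ord_inj).
have -> : (\det K * (afun lam * dfun (lam - eta)))%:M = (\det K)%:M *
  \prod_(n < N) ((lam - xi (rev_ord n) +
     (eta / 2 + ((tws (rev_ord n))%:R / 2) * eta)) *
     (lam - xi (rev_ord n) - (eta / 2 + ((tws (rev_ord n))%:R / 2) * eta)))%:M
     :> opH.
  rewrite prod_scalar_mx scalar_mxM mulmxE; congr (_ * _%:M).
  rewrite /a_fun /d_fun -big_split /= [RHS](reindex_inj rev_ord_inj) /=.
  by apply: eq_bigr => n _; rewrite /xik rev_ordK; field.
apply: qdet_relM; last by apply: lift_comm.
  move=> i k; rewrite !mxE -!mulmxE -!scalar_mxM -raddfB /= det_mx22.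
  case: (ord2_cases i) => ->; case: (ord2_cases k) => -> /=.
  - by rewrite mulrC subrr raddf0.
  - by [].
  - by rewrite -raddfN /= opprB mulrC [K 1 1 * _]mulrC.
  - by rewrite mulrC subrr raddf0.
apply: qdet_rel_prod; rewrite ?index_enum_uniq //; try by move=> n m; apply: rl.
move=> n; have -> : lam - eta - xi (rev_ord n) = lam - xi (rev_ord n) - eta.
  by rewrite addrAC.
exact: lax_qdet.
Qed.

Definition transfer1 K lam : opH := \tr (mono K lam).

Lemma transfer1_comm K lam mu :
  transfer1 K lam *m transfer1 K mu = transfer1 K mu *m transfer1 K lam.
Proof.
have [->//|lm] := eqVneq lam mu.
rewrite mulmxE.
apply: (@rtt_trace_comm _ eta%:M (lam - mu)%:M); try exact: central_scalar.
- move=> x; rewrite -mulmxE mul_scalar_mx => /eqP; rewrite scaler_eq0 subr_eq0.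
  by rewrite (negPf lm) => /eqP.
- move=> x /eqP; rewrite -scaler_nat scaler_eq0 pnatr_eq0 => /eqP //.
- exact: rtt_monodromy.
- by rewrite -raddfN /= opprB; apply: rtt_monodromy.
Qed.

Lemma lower_triangular_vacuum n (v : 'rV[C]_n) (I : eqType) (r : seq I)
    (L : I -> 'M['M[C]_n]_2) (alpha delta : I -> C) : uniq r ->
  (forall i j, i != j -> entries_comm (L i) (L j)) ->
  (forall i, v *m L i 0 0 = alpha i *: v) ->
  (forall i, v *m L i 0 1 = 0) ->
  (forall i, v *m L i 1 1 = delta i *: v) ->
  let P := \prod_(i <- r) L i in
  [/\ v *m P 0 0 = (\prod_(i <- r) alpha i) *: v, v *m P 0 1 = 0 &
      v *m P 1 1 = (\prod_(i <- r) delta i) *: v].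
Proof.
move=> ur cL va vb vd /=; elim: r ur => [|i r IH] /=.
  by rewrite !big_nil !mxE /= !mulmx1 mulmx0 !scale1r.
case/andP=> ir ur; have [IHa IHb IHd] := IH ur; rewrite !big_cons.
have cP : entries_comm (L i) (\prod_(j <- r) L j).
  by apply: entries_comm_prod => j jr; apply: cL; apply: contraNneq ir => ->.
rewrite !mxE !big_ord2; split.
- by rewrite mulmxDr -!mulmxE !mulmxA va vb mul0mx addr0 -scalemxAl IHa scalerA.
- by rewrite mulmxDr -!mulmxE !mulmxA va vb mul0mx addr0 -scalemxAl IHb scaler0.
(* Nothing is known of v L_i 1 0, so P 0 1, which kills v, is commuted to the front. *)
- rewrite cP mulmxDr -!mulmxE !mulmxA IHb vd mul0mx add0r -scalemxAl IHd.
  by rewrite scalerA.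
Qed.

(** The untwisted product kills [bra0] through its entry 0 1, so only K_01 and K_11 times its entry
    1 1 survive. A nonzero K_01 thus gives B a nonzero eigenvalue, with zeros at the points
    xi_n^(0). *)
Lemma bra0_monodromy K lam :
  bra0 *m mono K lam 0 1 = (K 0 1 * dfun lam) *: bra0 /\
  bra0 *m mono K lam 1 1 = (K 1 1 * dfun lam) *: bra0.
Proof.
have rl (n m : 'I_N) x y : n != m ->
    entries_comm (lax (rev_ord n) x) (lax (rev_ord m) y).
  by move=> nm; apply: lax_comm; rewrite (inj_eq rev_ord_inj).
have [||||| _ vb vd] := @lower_triangular_vacuum _ (bra0 : 'rV[C]_#|{: config}|) _
  (index_enum 'I_N) (fun n => lax (rev_ord n) (lam - xi (rev_ord n)))
  (fun n => lam - xi (rev_ord n) + eta / 2 + ((tws (rev_ord n))%:R / 2) * eta)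
  (fun n => lam - xi (rev_ord n) + eta / 2 - ((tws (rev_ord n))%:R / 2) * eta).
- exact: index_enum_uniq.
- by move=> n m nm; apply: rl.
- move=> n; rewrite laxE; apply: bra0_site.
  by apply/rowP=> k; rewrite local_laxE !mxE /= mul1r; case: k => [[|k] ?];
    rewrite -!val_eqE /= ?mulr1n ?mulr0n ?mulr1 ?mulr0 ?addr0 ?subr0 ?mulr0 //=; field.
- move=> n; rewrite laxE -[RHS](scale0r bra0); apply: bra0_site.
  by apply/rowP=> k; rewrite local_laxE !mxE /= !mul0r mul0rn mulr0 addr0.
- move=> n; rewrite laxE; apply: bra0_site.
  by apply/rowP=> k; rewrite local_laxE !mxE /= mul1r; case: k => [[|k] ?];
    rewrite -!val_eqE /= ?mulr1n ?mulr0n ?mulr1 ?mulr0 ?addr0 ?subr0 ?mulr0 //=; field.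
have dE : dfun lam = \prod_(n < N)
    (lam - xi (rev_ord n) + eta / 2 - ((tws (rev_ord n))%:R / 2) * eta).
  rewrite [RHS](reindex_inj rev_ord_inj) /=.
  by apply: eq_bigr => n _; rewrite rev_ordK /xik; field.
rewrite /monodromy !mxE !big_ord2 !mxE !mulmxDr -!mulmxE !mulmxA !mul_mx_scalar.
by rewrite -!scalemxAl vb vd !scaler0 !add0r -!scalerA dE.
Qed.

End Monodromy.

(** * Fusion *)

Section Fusion.

Variables (A : pzRingType) (M : nat -> 'M[A]_2) (q : nat -> A).
Hypothesis Mq : forall k, qdet_rel (M k) (M k.+1) (q k).

(* Coefficient of y^a in the product of the M_(k+i)(0, w_i) + M_(k+i)(1, w_i) y
   over the letters w_i of w, where y is a central variable. *)
Fixpoint row_coef (k : nat) (w : seq 'I_2) (a : nat) : A :=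
  if w is b :: w' then
    M k 0 b * row_coef k.+1 w' a +
    (if a is a'.+1 then M k 1 b * row_coef k.+1 w' a' else 0)
  else (a == 0%N)%:R.

Lemma row_coef_cons k b w a : row_coef k (b :: w) a =
  M k 0 b * row_coef k.+1 w a +
    (if a is a'.+1 then M k 1 b * row_coef k.+1 w a' else 0).
Proof. by []. Qed.

Lemma row_coef_oversize k w a : (size w < a)%N -> row_coef k w a = 0.
Proof.
elim: w k a => [|b w IH] k [|a] //= wa.
by rewrite !IH ?mulr0 ?addr0 // ltnW.
Qed.

(** Exchanging two neighbouring columns changes M_k M_(k+1) by a tensor antisymmetric in its two
    rows. Rows are recorded only by their number of letters 1, so q and - q cancel. *)
Lemma row_coef_swap k w a : row_coef k [:: 0, 1 & w] a = row_coef k [:: 1, 0 & w] a.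
Proof.
have sym i : M k i 0 * M k.+1 i 1 = M k i 1 * M k.+1 i 0.
  by apply/eqP; rewrite -subr_eq0 Mq eqxx.
have asym : M k 0 0 * M k.+1 1 1 + M k 1 0 * M k.+1 0 1 =
    M k 0 1 * M k.+1 1 0 + M k 1 1 * M k.+1 0 0.
  have e0 : M k 0 0 * M k.+1 1 1 = q k + M k 0 1 * M k.+1 1 0.
    by rewrite -[q k](Mq k 0 1) subrK.
  have e1 : M k 1 0 * M k.+1 0 1 = - q k + M k 1 1 * M k.+1 0 0.
    by rewrite -[- q k](Mq k 1 0) subrK.
  by rewrite e0 e1 addrACA subrr add0r.
case: a => [|[|a]] /=; rewrite ?addr0 ?mulrDr !mulrA.
- by rewrite sym.
- by rewrite sym -!addrA -!mulrDl asym.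
- rewrite !sym !addrA; congr (_ + _); rewrite -!addrA; congr (_ + _).
  by rewrite -!mulrDl asym.
Qed.

Definition sorted_word i j : seq 'I_2 := nseq i 0 ++ nseq j 1.

Lemma row_coef_sorted k w a :
  row_coef k w a = row_coef k (sorted_word (count_mem 0 w) (count_mem 1 w)) a.
Proof.
elim: w k a => [|b w IH] k a //.
have bubble i j k' a' : row_coef k' (1 :: sorted_word i j) a' =
    row_coef k' (sorted_word i j.+1) a'.
  elim: i k' a' => [|i IHi] k' a' //.
  rewrite -[sorted_word i.+1 j]/(0 :: sorted_word i j) -row_coef_swap.
  rewrite -[sorted_word i.+1 j.+1]/(0 :: sorted_word i j.+1) row_coef_cons.
  by rewrite [RHS]row_coef_cons IHi; case: a' => [|a'] //; rewrite IHi.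
have E : row_coef k (b :: w) a =
   row_coef k (b :: sorted_word (count_mem 0 w) (count_mem 1 w)) a.
  by rewrite !row_coef_cons (IH _ a); case: a => [|a] //; rewrite (IH _ a).
rewrite E; case: (ord2_cases b) => ->; first by [].
by rewrite bubble.
Qed.

(* Symmetrizing the rows of M_k M_(k+1) ... makes it symmetric in its columns
   as well (row_coef_swap), so the trace over symmetric tensors only needs one
   column word per number of letters 1. *)
Definition sym_trace k l : A := \sum_(j < l.+1) row_coef k (sorted_word (l - j) j) j.

Lemma sym_trace0 k : sym_trace k 0 = 1.
Proof. by rewrite /sym_trace big_ord_recl big_ord0 addr0. Qed.

Lemma sym_trace1 k : sym_trace k 1 = \tr (M k).
Proof.
by rewrite /sym_trace /mxtrace !big_ord2 /= !mulr0 !addr0 add0r !mulr1.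
Qed.

(** Expanding the left side along its first letter produces M_k 0 0 times the trace of length l + 1,
    a family of terms in M_k 1 0, and one last term in M_k 1 1. What tr M_k times that trace has in
    excess combines M_k 1 1 and M_k 1 0 with the column words extended by 0 and by 1, which is where
    the quantum determinant appears. *)
Lemma sym_traceS k l :
  sym_trace k l.+2 = \tr (M k) * sym_trace k.+1 l.+1 - q k * sym_trace k.+2 l.
Proof.
have q0 : M k 1 1 * M k.+1 0 0 - M k 1 0 * M k.+1 0 1 = q k.
  by rewrite -opprB Mq /= opprK.
have q1 : M k 1 1 * M k.+1 1 0 - M k 1 0 * M k.+1 1 1 = 0.
  by rewrite -opprB Mq /= oppr0.
have E : q k * sym_trace k.+2 l =
    \sum_(j < l.+1) (M k 1 1 * row_coef k.+1 (sorted_word (l.+1 - j) j) j -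
                     M k 1 0 * row_coef k.+1 (sorted_word (l - j) j.+1) j).
  rewrite mulr_sumr; apply: eq_bigr => j _.
  have jl : (j <= l)%N by rewrite -ltnS.
  rewrite subSn // -[sorted_word (_.+1) j]/(0 :: sorted_word (l - j) j).
  have -> : row_coef k.+1 (sorted_word (l - j) j.+1) j =
      row_coef k.+1 (1 :: sorted_word (l - j) j) j.
    rewrite [RHS]row_coef_sorted; congr (row_coef _ (sorted_word _ _) _);
    by rewrite /sorted_word /= count_cat !count_nseq /= ?mul1n ?mul0n ?addn0 ?add0n.
  rewrite -q0 /= !mulrDr !mulrA opprD addrACA -mulrBl.
  case: (val j) => [|j'] /=; first by rewrite !mulr0 subrr addr0.
  by rewrite !mulrA -mulrBl q1 mul0r addr0.
apply/eqP; rewrite eq_sym subr_eq E; apply/eqP.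
have -> : sym_trace k l.+2 = M k 0 0 * sym_trace k.+1 l.+1 +
    (\sum_(j < l.+1) M k 1 0 * row_coef k.+1 (sorted_word (l - j) j.+1) j +
     M k 1 1 * row_coef k.+1 (sorted_word 0 l.+1) l.+1).
  rewrite /sym_trace big_ord_recr /= subnn -[sorted_word 0 l.+2]/(1 :: sorted_word 0 l.+1).
  rewrite row_coef_cons (row_coef_oversize k.+1); last by rewrite size_nseq.
  rewrite mulr0 add0r addrA; congr (_ + _).
  rewrite mulr_sumr big_ord_recl [X in _ = X + _]big_ord_recl -[RHS]addrA.
  congr (_ + _).
    by rewrite -[sorted_word (l.+2 - _) _]/(0 :: sorted_word l.+1 0) row_coef_cons addr0.
  rewrite -big_split; apply: eq_bigr => j _.
  have jl : (j <= l)%N by rewrite -ltnS.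
  rewrite (_ : (lift ord0 j : nat) = j.+1) // !subSS (_ : l.+1 - j = (l - j).+1)%N ?subSn //.
rewrite sumrB /mxtrace big_ord2 mulrDl -addrA; congr (_ + _).
have -> : sym_trace k.+1 l.+1 = \sum_(j < l.+1)
    row_coef k.+1 (sorted_word (l.+1 - j) j) j + row_coef k.+1 (sorted_word 0 l.+1) l.+1.
  by rewrite /sym_trace big_ord_recr [X in _ + X = _]/= subnn.
by rewrite mulrDr mulr_sumr [RHS]addrC [X in _ = _ + X]addrC addrA addrAC subrK addrC.
Qed.

End Fusion.

(** * Words counted by their letters 1, and the trace over symmetric tensors *)

Section Words.

Definition ones l (w : word l) : nat := #|[set k | w k == 1]|.

Lemma onesE l (w : word l) : ones w = (\sum_(k < l) (w k == 1%R))%N.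
Proof. by rewrite /ones -sum1dep_card big_mkcond; apply: eq_bigr => k _; case: eqP. Qed.

Lemma ones_le l (w : word l) : (ones w <= l)%N.
Proof. by rewrite -[X in (_ <= X)%N](card_ord l) max_card. Qed.

Lemma ones_perm l (w : word l) (s : 'S_l) : ones [ffun k => w (s k)] = ones w.
Proof.
rewrite !onesE [RHS](reindex_inj (@perm_inj _ s)) /=.
by apply: eq_bigr => k _; rewrite ffunE.
Qed.

Lemma card_ones l j : #|[pred w : word l | ones w == j]| = 'C(l, j).
Proof.
rewrite -[l in RHS]card_ord -card_draws -[RHS](card_imset _
  (f := fun B : {set 'I_l} => [ffun k => if k \in B then 1 else 0] : word l)).
  rewrite -cardsE; apply: eq_card => w; rewrite !inE; apply/idP/imsetP => [wj | [B]].
    exists [set k | w k == 1]; first by rewrite inE.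
    by apply/ffunP => k; rewrite ffunE inE; case: (ord2_cases (w k)) => ->.
  rewrite inE => Bj ->; rewrite /ones (_ : [set k | _] = B) //.
  by apply/setP => k; rewrite inE ffunE; case: ifP.
move=> B B' /ffunP eB; apply/setP => k; move: (eB k); rewrite !ffunE.
by case: ifP; case: ifP.
Qed.

Definition word_cons l (x : 'I_2) (w : word l) : word l.+1 :=
  [ffun i => if unlift ord0 i is Some j then w j else x].

Lemma word_cons0 l x (w : word l) : word_cons x w ord0 = x.
Proof. by rewrite ffunE unlift_none. Qed.

Lemma word_consS l x (w : word l) i : word_cons x w (lift ord0 i) = w i.
Proof. by rewrite ffunE liftK. Qed.

Lemma ones_cons l x (w : word l) : ones (word_cons x w) = ((x == 1%R) + ones w)%N.
Proof.
rewrite !onesE big_ord_recl word_cons0; congr (_ + _)%N.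
by apply: eq_bigr => i _; rewrite word_consS.
Qed.

Lemma sum_word_cons (V : nmodType) l (F : word l.+1 -> V) :
  \sum_w F w = \sum_(x : 'I_2) \sum_(w : word l) F (word_cons x w).
Proof.
rewrite pair_big /= (reindex (fun p : 'I_2 * word l => word_cons p.1 p.2)) //=.
exists (fun w : word l.+1 => (w ord0, [ffun j => w (lift ord0 j)])) => [[x w] _|w _] /=.
  by congr (_, _); [apply: word_cons0 | apply/ffunP => j; rewrite ffunE word_consS].
by apply/ffunP => i; rewrite ffunE; case: unliftP => [j ->|->] //=; rewrite ffunE.
Qed.

Section SumWords.
Variables (A : pzRingType) (M : nat -> 'M[A]_2).

Lemma row_coef_sum l k (b : nat -> 'I_2) a :
  \sum_(w : word l | ones w == a) \prod_(i < l) M (k + i) (w i) (b i) =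
  row_coef M k (mkseq b l) a.
Proof.
elim: l k b a => [|l IH] k b a.
  rewrite big_mkcond (bigD1 [ffun i => 0]) //= [X in _ + X]big1 => [|w].
    rewrite big_ord0 addr0 onesE big_ord0 eq_sym; by case: eqP.
  by case/eqP; apply/ffunP => -[].
rewrite big_mkcond sum_word_cons.
have E x : \sum_(w : word l) (if ones (word_cons x w) == a then
      \prod_(i < l.+1) M (k + i) (word_cons x w i) (b i) else 0) =
    M k x (b 0) * \sum_(w : word l | ((x == 1%R) + ones w == a)%N)
      \prod_(i < l) M (k.+1 + i) (w i) (b i.+1).
  rewrite mulr_sumr [RHS]big_mkcond; apply: eq_bigr => w _.
  rewrite ones_cons big_ord_recl word_cons0 addn0.
  case: ifP => // _; congr (_ * _); apply: eq_bigr => i _.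
  by rewrite word_consS /= /bump leq0n add1n addnS addSn.
rewrite big_ord2 !E -[mkseq b l.+1]/(b 0 :: map b (iota 1 l)).
have -> : map b (iota 1 l) = mkseq (fun i => b i.+1) l.
  by rewrite /mkseq -[1%N]/(1 + 0)%N iotaDl -map_comp.
rewrite row_coef_cons -IH; congr (_ * _ + _).
case: a {E} => [|a]; last by rewrite -IH.
by rewrite big_pred0 ?mulr0.
Qed.

Lemma row_coef_word (q : nat -> A) l (w' : word l) a :
  (forall k, qdet_rel (M k) (M k.+1) (q k)) ->
  \sum_(w : word l | ones w == a) \prod_(k < l) M k (w k) (w' k) =
  row_coef M 0 (sorted_word (l - ones w') (ones w')) a.
Proof.
(* The value 0 beyond [l] is a default which [mkseq b l] never reads. *)
move=> Mq; pose b i := oapp w' 0 (insub i).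
have -> : \sum_(w : word l | ones w == a) \prod_(k < l) M k (w k) (w' k) =
    \sum_(w : word l | ones w == a) \prod_(k < l) M (0 + k)%N (w k) (b k).
  by apply: eq_bigr => w _; apply: eq_bigr => k _; rewrite /b valK.
rewrite row_coef_sum (row_coef_sorted Mq) /=.
have c1 : count_mem 1 (mkseq b l) = ones w'.
  rewrite onesE /mkseq count_map -sum1_count -val_enum_ord big_map big_enum_cond /=.
  by rewrite [RHS]big_mkcond /= big_mkcond; apply: eq_bigr => k _; rewrite /b valK /=; case: eqP.
have c0 : (count_mem 0%R (mkseq b l) + count_mem 1%R (mkseq b l))%N = l.
  rewrite -[RHS](size_mkseq b l) -(count_predC (pred1 0%R)); congr (_ + _)%N.
  by apply: eq_count => x /=; case: (ord2_cases x) => ->.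
rewrite c1; congr (row_coef _ _ (sorted_word _ _) _); apply/eqP.
by rewrite -(eqn_add2r (count_mem 1%R (mkseq b l))) c0 c1 subnK // ones_le.
Qed.

End SumWords.
End Words.

Section SymTrace.

Variables (C : numClosedFieldType) (N : nat) (tws : 'I_N -> nat).
Local Notation opH := 'M[C]_#|{: config tws}|.

Lemma sym_basisE l (i : 'I_#|{: word l}|) (j : 'I_l.+1) :
  @sym_basis C l i j = (ones (enum_val i : word l) == j)%:R * (sqrtC 'C(l, j)%:R)^-1.
Proof. by rewrite mxE -/(ones _); case: eqP; rewrite ?mul1r ?mul0r. Qed.

Lemma sum_perm_avg l (f : 'S_l -> C) c : (forall s, f s = c) ->
  (l`!)%:R^-1 * \sum_(s : 'S_l) f s = c.
Proof.
move=> fc; rewrite (eq_bigr (fun=> c)) // sumr_const card_Sn.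
by rewrite -(mulr_natl c) mulKf // pnatr_eq0 -lt0n fact_gt0.
Qed.

Lemma sym_proj_basis l : @sym_proj C l *m sym_basis l = sym_basis l.
Proof.
apply/matrixP=> i j; rewrite !mxE.
under eq_bigr do rewrite mxE -mulrA mulr_suml.
rewrite -mulr_sumr exchange_big /=; apply: sum_perm_avg => s.
transitivity (\sum_(w : word l) (w == [ffun k => (enum_val i : word l) (s k)])%:R *
   (if ones w == j then (sqrtC 'C(l, j)%:R)^-1 : C else 0)).
  by rewrite [RHS]big_enum_val /=; apply: eq_bigr => k _; rewrite mxE.
rewrite (bigD1 [ffun k => (enum_val i : word l) (s k)]) //= eqxx mul1r big1 ?addr0.
  by rewrite ones_perm.
by move=> w /negPf ->; rewrite mul0r.
Qed.

Lemma sym_basis_proj l : (sym_basis l)^T *m @sym_proj C l = (sym_basis l)^T.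
Proof.
apply/matrixP=> j i; rewrite !mxE.
under eq_bigr do rewrite !mxE mulrCA mulr_sumr.
rewrite -mulr_sumr exchange_big /=; apply: sum_perm_avg => s.
transitivity (\sum_(w : word l) (if ones w == j then (sqrtC 'C(l, j)%:R)^-1 : C else 0) *
   ((enum_val i : word l) == [ffun k => w (s k)])%:R).
  by rewrite [RHS]big_enum_val.
rewrite (bigD1 [ffun k => (enum_val i : word l) ((s^-1)%g k)]) //= big1 ?addr0.
  rewrite ones_perm (_ : [ffun k => _] = enum_val i) ?eqxx ?mulr1 //.
  by apply/ffunP=> k; rewrite !ffunE permK.
move=> w ww; have [ei|_] := eqVneq (enum_val i : word l) [ffun k => w (s k)];
  last by rewrite mulr0.
by case/eqP: ww; apply/ffunP=> k; rewrite ei !ffunE permKV.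
Qed.

Lemma lift_opM p m n (X : 'M[C]_(p, m)) (Y : 'M[C]_(m, n)) :
  lift_op tws (X *m Y) = lift_op tws X *m lift_op tws Y.
Proof. by rewrite /lift_op map_mxM. Qed.

(** [sym_basis] absorbs the symmetrizers. Its two normalizations combine to 1 / 'C(l, j),
    compensated by the 'C(l, j) column words with j letters 1, which all contribute the same
    [row_coef]. *)
Lemma trace_symE l (M : nat -> 'M[opH]_2) (q : nat -> opH) :
  (forall k, qdet_rel (M k) (M k.+1) (q k)) ->
  trace_sym (lift_op tws (sym_proj l) *m
    \matrix_(i, j) (\prod_(k < l)
      M k ((enum_val i : word l) k) ((enum_val j : word l) k)) *m
    lift_op tws (sym_proj l)) = sym_trace M 0 l.
Proof.
move=> Mq; rewrite /trace_sym !mulmxA -lift_opM sym_basis_proj -!mulmxA -lift_opM.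
rewrite sym_proj_basis mulmxA /sym_trace /mxtrace; apply: eq_bigr => j _.
rewrite mxE.
transitivity (\sum_(w' : word l) \sum_(w : word l)
  (((ones w == j)%:R * (sqrtC 'C(l, j)%:R)^-1) *
   ((ones w' == j)%:R * (sqrtC 'C(l, j)%:R)^-1)) *:
    \prod_(k < l) M k (w k) (w' k)).
  have lE (X : 'M[C]_(#|{: word l}|, l.+1)) i : lift_op tws X i j = (X i j)%:M.
    by rewrite mxE.
  have lTE (X : 'M[C]_(#|{: word l}|, l.+1)) i : lift_op tws X^T j i = (X i j)%:M.
    by rewrite 2!mxE.
  rewrite [RHS]big_enum_val /=; apply: eq_bigr => k _.
  rewrite [RHS]big_enum_val /= lE [X in X * _]mxE mulr_suml; apply: eq_bigr => i _.
  rewrite lTE [X in _ * X * _]mxE !sym_basisE.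
  by rewrite -!mulmxE mul_mx_scalar mul_scalar_mx scalerA mulrC.
transitivity (\sum_(w' : word l | ones w' == j) 'C(l, j)%:R^-1 *:
   row_coef M 0 (sorted_word (l - j) j) j).
  rewrite [RHS]big_mkcond; apply: eq_bigr => w' _; case: (eqVneq (ones w') j) => [wj|_];
    last by rewrite big1 // => w _; rewrite mul0r mulr0 scale0r.
  have l_gt0 : ('C(l, j)%:R : C) != 0 by rewrite pnatr_eq0 -lt0n bin_gt0 -ltnS.
  transitivity ('C(l, j)%:R^-1 *: \sum_(w : word l | ones w == j)
       \prod_(k < l) M k (w k) (w' k)).
    rewrite scaler_sumr [RHS]big_mkcond; apply: eq_bigr => w _.
    rewrite !mul1r -mulrA -expr2 exprVn sqrtCK.
    by case: eqP => _; rewrite ?mul1r ?mul0r ?scale0r.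
  congr (_ *: _).
  by rewrite (row_coef_word _ _ Mq) wj.
rewrite sumr_const; rewrite (eq_card (B := [pred w : word l | ones w == j])) // card_ones.
rewrite -scaler_nat scalerA mulfV ?scale1r //.
by rewrite pnatr_eq0 -lt0n bin_gt0 -ltnS.
Qed.

End SymTrace.

(** * Continuants and fused transfer matrices *)

Section Continuants.

Variables (A : pzRingType) (t q : nat -> A).
Hypothesis qC : forall k, central (q k).

(** Tridiagonal determinant on the window k, ..., k + l - 1, expanded from its first index; the
    weight [q k] goes with the removal of the neighbours k and k + 1. *)
Fixpoint continuant (l k : nat) : A :=
  if l is l'.+1 then
    if l' is l''.+1 then t k * continuant l' k.+1 - q k * continuant l'' k.+2
    else t k
  else 1.

Lemma continuantSS l k :
  continuant l.+2 k = t k * continuant l.+1 k.+1 - q k * continuant l k.+2.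
Proof. by []. Qed.

Lemma continuant_recr l k :
  continuant l.+2 k = continuant l.+1 k * t (k + l.+1) - q (k + l) * continuant l k.
Proof.
(* The recursion has depth two, so two consecutive lengths are carried together. *)
suff: forall k, continuant l.+2 k =
    continuant l.+1 k * t (k + l.+1) - q (k + l) * continuant l k /\
  continuant l.+3 k =
    continuant l.+2 k * t (k + l.+2) - q (k + l.+1) * continuant l.+1 k.
  by move/(_ k) => [].
elim: l {k} => [|l IH] k.
  split; first by rewrite /= addn1 addn0.
  rewrite !continuantSS /= !mulr1 addn1 addn2 mulrBr mulrBl mulrA -!addrA.
  by rewrite [- _ - _]addrC (qC k.+1).
have [_ E2] := IH k; split=> //.
have [F1 F2] := IH k.+1; have [G1 _] := IH k.+2.
rewrite continuantSS F2 G1 (continuantSS l.+1 k) (continuantSS l k) !addSn !addnS.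
move: (continuant l.+2 k.+1) (continuant l.+1 k.+1) (continuant l.+1 k.+2)
  (continuant l k.+2) => b c d e.
rewrite !mulrBl !mulrBr !mulrA !opprB.
have -> : t k * q (k + l).+2 = q (k + l).+2 * t k by rewrite qC.
have -> : q k * q (k + l).+2 = q (k + l).+2 * q k by rewrite qC.
by rewrite addrACA [RHS]addrACA [X in _ + X = _]addrC.
Qed.

Lemma continuant_comm z :
  (forall k, t k * z = z * t k) ->
  forall l k, continuant l k * z = z * continuant l k.
Proof.
move=> tz l k.
suff: forall k, continuant l k * z = z * continuant l k /\
  continuant l.+1 k * z = z * continuant l.+1 k by move/(_ k) => [].
elim: l {k} => [|l IH] k; first by split; rewrite /= ?mul1r ?mulr1.
have [_ E] := IH k; split=> //.
have [_ F] := IH k.+1; have [G _] := IH k.+2.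
rewrite continuantSS mulrBl mulrBr -mulrA F -[q k * _ * _]mulrA G.
by rewrite !mulrA tz qC.
Qed.

Hypothesis tC : forall j k, t j * t k = t k * t j.

(** Two overlapping windows, k + 1, ..., k + n and k, ..., k + h, are compared with their union and
    intersection. Expanding the two windows that start at k, the terms in [t k] cancel and what
    remains is [q k] times the identity for h - 1 at k + 1. *)
Lemma continuant_euler h n k : (h < n)%N ->
  continuant n k.+1 * continuant h.+1 k =
  continuant n.+1 k * continuant h k.+1 +
    (\prod_(i < h.+1) q (k + i)) * continuant (n - h.+1) (k + h.+2).
Proof.
elim: h n k => [|h IH] [//|n] k hn.
  rewrite [continuant 1 k]/= (continuant_comm (tC^~ _)) continuantSS mulr1 big_ord_recl big_ord0.
  by rewrite mulr1 addn0 subSS subn0 addn2 subrK.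
rewrite (continuantSS h k) (continuantSS n k) big_ord_recl addn0.
have -> : \prod_(i < h.+1) q (k + lift ord0 i) = \prod_(i < h.+1) q (k.+1 + i).
  by apply: eq_bigr => i _; rewrite /= /bump leq0n add1n addnS addSn.
have := IH n k.+1 hn; rewrite subSS !addSn !addnS.
have tc : t k * continuant n.+1 k.+1 = continuant n.+1 k.+1 * t k.
  by rewrite (continuant_comm (tC^~ _)).
move: (continuant n.+1 k.+1) (continuant h.+1 k.+1) (continuant h k.+2)
  (continuant n k.+2) (continuant _ _) (\prod_(i < _) _) tc => a b c d r Q tc E.
rewrite mulrBr mulrBl -[_ * d * b]mulrA E mulrDr opprD addrA !mulrA tc subrK.
by rewrite (qC k).
Qed.

End Continuants.

Section Shift.
Variables (A : pzRingType) (M : nat -> 'M[A]_2) (k : nat).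

Lemma row_coef_shift s w a :
  row_coef M (k + s) w a = row_coef (fun i => M (k + i)%N) s w a.
Proof.
elim: w a s => [|b w IH] a s; first by [].
by rewrite !row_coef_cons -addnS IH; case: a => [|a]; rewrite ?IH.
Qed.

Lemma sym_trace_shift l : sym_trace M k l = sym_trace (fun i => M (k + i)%N) 0 l.
Proof. by apply: eq_bigr => i _; rewrite -row_coef_shift addn0. Qed.

End Shift.

(** * Fused transfer matrices as continuants on a string of points *)

Section TransferContinuant.

Variables (C : numClosedFieldType) (N : nat) (tws : 'I_N -> nat).
Variables (eta : C) (eta0 : eta != 0) (xi : 'I_N -> C) (K : 'M[C]_2).
Local Notation config := (config tws).
Local Notation opH := 'M[C]_#|{: config}|.
Local Notation mono := (@monodromy C N tws eta xi K).
Local Notation afun := (@a_fun C N tws eta xi).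
Local Notation dfun := (@d_fun C N tws eta xi).

Definition qdet_at lam : C := \det K * (afun lam * dfun (lam - eta)).

(** The window x - k eta, ..., x - (k + l - 1) eta. The base point x is kept apart from k so that
    all windows of one string are continuants of the same two sequences. *)
Definition fused x l k : opH :=
  continuant (fun j => transfer1 tws eta xi K (x - j%:R * eta))
    (fun j => (qdet_at (x - j%:R * eta))%:M) l k.

Lemma fused_recr x l k : fused x l.+2 k =
  fused x l.+1 k *m transfer1 tws eta xi K (x - (k + l.+1)%:R * eta) -
  qdet_at (x - (k + l)%:R * eta) *: fused x l k.
Proof.
rewrite /fused continuant_recr; last by move=> j; apply: central_scalar.
by rewrite -!mulmxE mul_scalar_mx.
Qed.

(** The spectral parameter of T^(K|l) is the last point of its window. For l = 0 both sides are 1,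
    whatever the parameter. *)
Lemma transfer_fused x l k :
  transfer tws eta xi K l (x - (k + l.-1)%:R * eta) = fused x l k.
Proof.
case: l => // l.
pose M j := mono (x - j%:R * eta).
have Mq j : qdet_rel (M j) (M j.+1) (qdet_at (x - j%:R * eta))%:M.
  rewrite /M (_ : x - j.+1%:R * eta = x - j%:R * eta - eta); first exact: qdet_monodromy.
  by rewrite -(natr1 j) mulrDl mul1r opprD addrA.
transitivity (sym_trace M k l.+1); last first.
  suff: forall k, sym_trace M k l = fused x l k /\ sym_trace M k l.+1 = fused x l.+1 k.
    by move/(_ k) => [].
  elim: l {k} => [|l IH] k; first by rewrite sym_trace0 sym_trace1.
  have [_ E] := IH k; split=> //.
  by rewrite (sym_traceS Mq) (proj2 (IH k.+1)) (proj1 (IH k.+2)).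
rewrite sym_trace_shift.
rewrite -(@trace_symE _ _ _ l.+1 (fun i => M (k + i)%N)
  (fun j => (qdet_at (x - (k + j)%:R * eta))%:M)); last by move=> j; rewrite addnS.
have -> : \matrix_(i, j) (\prod_(s < l.+1) M (k + s)%N
    ((enum_val i : word l.+1) s) ((enum_val j : word l.+1) s)) =
    @monodromies C N tws eta xi K l.+1 (x - (k + l)%:R * eta).
  apply/matrixP=> i j; rewrite [LHS]mxE [RHS]mxE; apply: eq_bigr => s _; rewrite /M.
  have -> : x - (k + s)%:R * eta = x - (k + l)%:R * eta + (l.+1.-1 - s)%:R * eta.
    have sl : (s <= l)%N by rewrite -ltnS.
    by rewrite natrB // !natrD; ring.
  by [].
by [].
Qed.

Lemma fused_comm x l k y l' k' :
  GRing.comm (fused x l k) (fused y l' k').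
Proof.
apply: continuant_comm => [j|j]; first exact: central_scalar.
apply/esym/continuant_comm => [i|i]; first exact: central_scalar.
by rewrite -mulmxE transfer1_comm.
Qed.

Lemma fused_euler x h n : (h < n)%N ->
  fused x n 1 *m fused x h.+1 0 =
  fused x n.+1 0 *m fused x h 1 +
    (\prod_(i < h.+1) qdet_at (x - i%:R * eta)) *: fused x (n - h.+1) h.+2.
Proof.
move=> hn; rewrite -mul_scalar_mx -prod_scalar_mx !mulmxE.
apply: continuant_euler hn => [j|i j]; first exact: central_scalar.
by rewrite -mulmxE transfer1_comm.
Qed.

End TransferContinuant.

(** * Eigenvectors of B and closure of the fusion hierarchy *)

Section LinearIndependence.
Variable C : numClosedFieldType.

Lemma poly_nonroot (p : {poly C}) : p != 0 -> exists x, p.[x] != 0.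
Proof.
move=> p0; have [/hasP [x _ px]|/hasPn nroot] :=
  boolP (has (fun x => p.[x] != 0) [seq i%:R | i <- iota 0 (size p)]).
  by exists x.
suff: (size [seq i%:R : C | i <- iota 0 (size p)] < size p)%N.
  by rewrite size_map size_iota ltnn.
apply: max_poly_roots => //.
  by apply/allP => x /nroot; rewrite negbK.
by rewrite map_inj_uniq ?iota_uniq //; apply: mulrIn; rewrite oner_eq0.
Qed.

Lemma eigenvectors_row_free p n (X : 'M[C]_(p, n)) (B : 'M[C]_n) (e : 'I_p -> C) :
  injective e -> (forall i, row i X *m B = e i *: row i X) ->
  (forall i, row i X != 0) -> row_free X.
Proof.
move=> e_inj XB X0; apply: inj_row_free => v vX.
have XB' : X *m B = diag_mx (\row_i e i) *m X.
  apply/row_matrixP => i; rewrite row_mul XB mul_diag_mx.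
  by apply/rowP => k; rewrite !mxE.
(* Applying B - c to a vanishing combination multiplies its k-th coefficient by e k - c; with all
   eigenvalues but e i, only the i-th term is left. *)
have annih (r : seq C) : (\row_k (v 0 k * \prod_(c <- r) (e k - c))) *m X = 0.
  elim: r => [|c r IH].
    rewrite -[RHS]vX; congr (_ *m _).
    by apply/rowP => k; rewrite mxE big_nil mulr1.
  have : (\row_k (v 0 k * \prod_(c <- r) (e k - c))) *m (X *m B - c *: X) = 0.
    by rewrite mulmxBr mulmxA -scalemxAr IH mul0mx scaler0 subrr.
  rewrite XB' -[c *: X]mul_scalar_mx -mulmxBl mulmxA => E; rewrite -[RHS]E.
  congr (_ *m _); apply/rowP => k.
  rewrite mulmxBr mul_mx_diag mul_mx_scalar !mxE big_cons.
  by rewrite [(e k - c) * _]mulrC mulrA mulrBr [c * _]mulrC.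
apply/rowP => i; rewrite mxE.
have := annih [seq e k | k <- enum 'I_p & k != i].
have -> : \row_k (v 0 k * \prod_(c <- [seq e k | k <- enum 'I_p & k != i]) (e k - c)) =
    (v 0 i * \prod_(c <- [seq e k | k <- enum 'I_p & k != i]) (e i - c)) *: delta_mx 0 i.
  apply/rowP => k; rewrite !mxE /=; have [->|ki] := eqVneq k i.
    by rewrite mulr1.
  rewrite mulr0; suff -> : \prod_(c <- [seq e k | k <- enum 'I_p & k != i]) (e k - c) = 0.
    by rewrite mulr0.
  apply/eqP; rewrite prodf_seq_eq0; apply/hasP; exists (e k); last by rewrite subrr eqxx.
  by rewrite map_f // mem_filter ki mem_enum.
rewrite -scalemxAl -rowE => /eqP; rewrite scaler_eq0 (negPf (X0 i)) orbF mulf_eq0.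
case/orP => [/eqP //|]; rewrite prodf_seq_eq0 => /hasP [c /mapP [k]].
rewrite mem_filter => /andP [ki _] -> /=; rewrite subr_eq0 => /eqP /e_inj ik.
by rewrite ik eqxx in ki.
Qed.

End LinearIndependence.

Section RttScalar.
Variables (C : numClosedFieldType) (n : nat) (eta u : C) (X Y : 'M['M[C]_n]_2).
Hypothesis XY : rtt eta%:M u%:M X Y.

Lemma rtt_scalar i j k l :
  u *: (X i j *m Y k l) + eta *: (X k j *m Y i l) =
  u *: (Y k l *m X i j) + eta *: (Y k j *m X i l).
Proof. by have := XY i j k l; rewrite -!mulmxE !mul_scalar_mx. Qed.

Lemma rtt_covec (v : 'rV[C]_n) i j k l :
  u *: (v *m X i j *m Y k l) + eta *: (v *m X k j *m Y i l) =
  u *: (v *m Y k l *m X i j) + eta *: (v *m Y k j *m X i l).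
Proof.
move: (congr1 (mulmx v) (rtt_scalar i j k l)).
by rewrite !mulmxDr -!scalemxAr !mulmxA.
Qed.

End RttScalar.

(** * The ladder of eigencovectors of B *)

Section Sklyanin.

Variables (C : numClosedFieldType) (N : nat) (tws : 'I_N -> nat).
Variables (eta : C) (eta0 : eta != 0) (xi : 'I_N -> C) (adm : admissible tws eta xi).
Local Notation config := (config tws).
Local Notation pt := (@xik C N tws eta xi).
Opaque monodromy.
Local Notation afun := (@a_fun C N tws eta xi).
Local Notation dfun := (@d_fun C N tws eta xi).

Lemma xikE n k : pt n k = pt n 0 - k%:R * eta.
Proof. by rewrite /xik; ring. Qed.

Lemma xikS n k : pt n k.+1 = pt n k - eta.
Proof. by rewrite (xikE n k.+1) (xikE n k) -(natr1 k); ring. Qed.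

(** On one string this is [eta != 0]; between two strings it is the condition of [admissible] on the
    points xi^(0). *)
Lemma xik_eq n k m l : (pt n k == pt m l) = (n == m) && (k == l).
Proof.
have [<-|nm] /= := eqVneq n m.
  rewrite (xikE n k) (xikE n l) (inj_eq (addrI _)) eqr_opp (inj_eq (mulIf eta0)).
  by rewrite eqr_nat.
apply/negbTE; have [_] := adm nm (k%:Z - l%:Z); apply: contraNneq.
rewrite (xikE n k) (xikE m l) => E.
rewrite -mulrzr intrB -!pmulrn -[pt n 0](subrK (k%:R * eta)) E; apply/eqP; ring.
Qed.

Lemma a_fun_neq0 n k : (k < tws n)%N -> afun (pt n k) != 0.
Proof.
move=> kn; apply/prodf_neq0 => m _; rewrite subr_eq0 xik_eq negb_and.
by case: (eqVneq n m) => //= <-; rewrite ltn_eqF.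
Qed.

Lemma d_fun_neq0 n k : (0 < k)%N -> dfun (pt n k) != 0.
Proof.
move=> kn; apply/prodf_neq0 => m _; rewrite subr_eq0 xik_eq negb_and.
by rewrite (gtn_eqF kn) orbT.
Qed.

Variables (K : 'M[C]_2) (K_unit : K \in unitmx) (K01 : K 0 1 != 0).
Local Notation mono := (@monodromy C N tws eta xi K).
Local Notation opA := (@opA C N tws eta xi K).
Local Notation qdet := (@qdet_at C N tws eta xi K).
Local Notation tr1 := (@transfer1 C N tws eta xi K).

Lemma qdet_neq0 n k : (k < tws n)%N -> qdet (pt n k) != 0.
Proof.
move=> kn; rewrite /qdet_at -xikS !mulf_neq0 ?a_fun_neq0 ?d_fun_neq0 //.
by rewrite -unitfE -unitmxE.
Qed.

(** The exchange relation reads (lam - mu + eta) [A(lam), A(mu)] = 0. If this factor vanishes, the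
    one with lam and mu exchanged equals 2 eta. *)
Lemma opA_comm lam mu : GRing.comm (opA lam) (opA mu).
Proof.
have [->|lm] := eqVneq lam mu; first exact: erefl.
have E u v : (u - v + eta) *: (opA u * opA v) = (u - v + eta) *: (opA v * opA u).
  have := rtt_scalar (rtt_monodromy tws eta xi K u v) 0 0 0 0.
  by rewrite -!scalerDl.
have [lme|lme] := eqVneq (lam - mu + eta) 0; last by apply: (scalerI lme).
apply/esym/(@scalerI _ _ (mu - lam + eta)); last exact: E.
have -> : mu - lam + eta = 2 * eta - (lam - mu + eta) by ring.
by rewrite lme subr0 mulf_neq0 // pnatr_eq0.
Qed.

Section Covector.
Variable v : 'rV[C]_#|{: config}|.

(** On the kernel of B(lam), A(lam) is a ladder operator: in the eigenvalue of B(mu) it replaces the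
    zero lam by lam - eta, the next point of the string. *)
Lemma covec_AB lam mu b : v *m mono lam 0 1 = 0 -> v *m mono mu 0 1 = b *: v ->
  mu != lam ->
  v *m opA lam *m mono mu 0 1 = (b * ((mu - (lam - eta)) / (mu - lam))) *: (v *m opA lam).
Proof.
move=> vl vm lm; have ml : mu - lam != 0 by rewrite subr_eq0.
have := rtt_covec (rtt_monodromy tws eta xi K mu lam) v 0 1 0 0.
rewrite vl mul0mx scaler0 addr0 vm -!scalemxAl !scalerA -scalerDl => /esym E.
apply: (scalerI ml); rewrite E scalerA; congr (_ *: _).
by field.
Qed.

Lemma covec_AD lam mu : v *m mono lam 0 1 = 0 -> v *m mono mu 0 1 = 0 -> mu != lam ->
  v *m opA lam *m mono mu 1 1 = v *m mono mu 1 1 *m opA lam.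
Proof.
move=> vl vm lm; have ml : mu - lam != 0 by rewrite subr_eq0.
have := rtt_covec (rtt_monodromy tws eta xi K mu lam) v 1 1 0 0.
rewrite vl vm !mul0mx scaler0 !addr0.
by move/(scalerI ml).
Qed.

(** In the quantum determinant the term containing B(lam) dies on v, so D(lam - eta) undoes
    A(lam). *)
Lemma covec_AD_shift lam : v *m mono lam 0 1 = 0 ->
  v *m opA lam *m mono (lam - eta) 1 1 = qdet lam *: v.
Proof.
move=> vl; have /= := @qdet_monodromy C N tws eta eta0 xi K lam 0 1.
move/(congr1 (mulmx v)); rewrite -!mulmxE mulmxBr !mulmxA vl mul0mx subr0 mul_mx_scalar.
by [].
Qed.

End Covector.

(** Labels are unbounded naturals rather than elements of [config], because [ladder_top] speaks of a
    label above the top of a string. *)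
Definition raise (n : 'I_N) (h : {ffun 'I_N -> nat}) : {ffun 'I_N -> nat} :=
  [ffun m => (h m + (m == n))%N].

Lemma labels_ind (P : {ffun 'I_N -> nat} -> Prop) :
  P [ffun=> 0%N] -> (forall h n, P h -> P (raise n h)) -> forall h, P h.
Proof.
move=> P0 PS h; elim: {h}(\sum_n h n)%N {-2}h (erefl (\sum_n h n)%N) => [|s IH] h hs.
  suff -> : h = [ffun=> 0%N] by [].
  by apply/ffunP => n; apply/eqP; rewrite ffunE -leqn0 -hs (bigD1 n) //= leq_addr.
have /existsP [n hn] : [exists n, h n != 0%N].
  apply: contra_eqT hs; rewrite negb_exists => /forallP h0.
  by rewrite big1 // => n _; apply/eqP/negPn/h0.
have -> : h = raise n [ffun m => (h m - (m == n))%N].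
  apply/ffunP => m; rewrite !ffunE subnK //.
  by case: eqP => [->|//]; rewrite lt0n.
apply: PS; apply: IH; apply/eqP; rewrite -eqSS -hs (bigD1 n) //= [in X in _ == X](bigD1 n) //=.
rewrite ffunE eqxx subn1 -addSn prednK ?lt0n //; apply/eqP; congr (_ + _)%N.
by apply: eq_bigr => m /negPf mn; rewrite ffunE mn subn0.
Qed.

(** Sklyanin's covectors without their normalization, whose denominator would vanish at
    xi_n^(2s_n). *)
Definition ladder (h : {ffun 'I_N -> nat}) : 'rV[C]_#|{: config}| :=
  bra0 *m \prod_(n < N) \prod_(k < h n) opA (pt n k).

Lemma ladder0 : ladder [ffun=> 0%N] = bra0.
Proof. by rewrite /ladder big1 ?mulmx1 // => n _; rewrite ffunE big_ord0. Qed.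

Lemma ladder_raise n h : ladder (raise n h) = ladder h *m opA (pt n (h n)).
Proof.
rewrite /ladder -mulmxA; congr (_ *m _).
transitivity (\prod_(m < N) ((\prod_(k < h m) opA (pt m k)) *
    (if m == n then opA (pt n (h n)) else 1))).
  apply: eq_bigr => m _; rewrite ffunE; case: eqP => [->|_]; last by rewrite addn0 mulr1.
  by rewrite addn1 big_ord_recr.
rewrite prodrM_comm; last first.
  move=> i j _ _; case: ifP => _; last exact: commr1.
  by apply/commr_sym/commr_prod => k _; apply: opA_comm.
rewrite mulmxE; congr (_ * _); rewrite -big_mkcond /=.
by rewrite (big_pred1 n).
Qed.

(* The exchange relation of A(lam) and B(mu) says nothing at mu = lam, so the
   points at which an operator A has already been applied must be avoided. *)
Definition fresh (h : {ffun 'I_N -> nat}) mu := forall m k, (k < h m)%N -> mu != pt m k.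

Lemma fresh_pt n h : fresh h (pt n (h n)).
Proof.
move=> m k km; rewrite xik_eq negb_and; case: eqVneq => //= nm.
by rewrite -nm in km; rewrite gtn_eqF.
Qed.

(** The operator A(xi_n^(h_n)) is applied at a zero of the current eigenvalue, so [covec_AB] moves
    this zero one step along the string. The induction hypothesis is used both at mu and at
    xi_n^(h_n). *)
Lemma ladder_B h mu : fresh h mu ->
  ladder h *m mono mu 0 1 = (K 0 1 * \prod_(n < N) (mu - pt n (h n))) *: ladder h.
Proof.
elim/labels_ind: h mu => [|h n IH] mu hmu.
  rewrite ladder0 (bra0_monodromy tws eta xi K mu).1; congr (_ * _ *: _).
  by apply: eq_bigr => m _; rewrite ffunE.
have hmu' : fresh h mu.
  by move=> m k km; apply: hmu; rewrite ffunE; apply: leq_trans km _; rewrite leq_addr.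
have mun : mu != pt n (h n) by apply: hmu; rewrite ffunE eqxx addn1.
rewrite ladder_raise (covec_AB _ (IH _ hmu')) //.
  congr (_ *: _); rewrite (bigD1 n) //= [in RHS](bigD1 n) //= ffunE eqxx addn1 xikS.
  rewrite [in RHS](eq_bigr (fun m => mu - pt m (h m))) => [|m /negPf mn].
    by field; rewrite subr_eq0.
  by rewrite ffunE mn addn0.
rewrite IH; last exact: fresh_pt.
by rewrite (bigD1 n) //= subrr mul0r mulr0 scale0r.
Qed.

Lemma ladder_B0 (h : {ffun 'I_N -> nat}) n : ladder h *m mono (pt n (h n)) 0 1 = 0.
Proof.
rewrite ladder_B; last exact: fresh_pt.
by rewrite (bigD1 n) //= subrr mul0r mulr0 scale0r.
Qed.

(** D(xi_n^(0)) kills [bra0] because d vanishes there. It passes through the operators A of the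
    other strings, as both B in the exchange relation vanish on the covector. *)
Lemma ladder_D0 (h : {ffun 'I_N -> nat}) n : h n = 0%N -> ladder h *m mono (pt n 0) 1 1 = 0.
Proof.
elim/labels_ind: h => [|h m IH].
  rewrite ladder0 (bra0_monodromy tws eta xi K _).2 /d_fun (bigD1 n) //= subrr.
  by rewrite mul0r mulr0 scale0r.
rewrite ffunE; case: eqVneq => [->|nm]; first by rewrite addn1.
rewrite addn0 => hn; have B1 := ladder_B0 h m.
have B2 : ladder h *m mono (pt n 0) 0 1 = 0 by have := ladder_B0 h n; rewrite hn.
rewrite ladder_raise (covec_AD B1 B2) ?xik_eq ?negb_and ?nm //.
by rewrite (IH hn) mul0mx.
Qed.

Lemma ladder_D (h : {ffun 'I_N -> nat}) n :
  ladder (raise n h) *m mono (pt n (h n).+1) 1 1 = qdet (pt n (h n)) *: ladder h.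
Proof. by rewrite ladder_raise xikS; apply/covec_AD_shift/ladder_B0. Qed.

(** D brings a covector back one step with a quantum determinant as weight, nonzero up to the top of
    the string; a vanishing covector would thus make [bra0] vanish. *)
Lemma ladder_neq0 (h : {ffun 'I_N -> nat}) : (forall n, (h n <= tws n)%N) -> ladder h != 0.
Proof.
elim/labels_ind: h => [_|h n IH hS].
  rewrite ladder0; apply/eqP => /rowP /(_ (enum_rank (@config0 N tws : config))).
  by rewrite !mxE enum_rankK eqxx => /eqP; rewrite oner_eq0.
have hn : (h n < tws n)%N by have := hS n; rewrite ffunE eqxx addn1.
have hh m : (h m <= tws m)%N.
  by apply: leq_trans (hS m); rewrite ffunE leq_addr.
apply/eqP => L0; have := ladder_D h n; rewrite L0 mul0mx => /esym/eqP.
by rewrite scaler_eq0 (negPf (qdet_neq0 hn)) (negPf (IH hh)).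
Qed.

Lemma ladders_row_free p (hs : 'I_p -> {ffun 'I_N -> nat}) : injective hs ->
  (forall i, ladder (hs i) != 0) -> row_free (\matrix_i ladder (hs i)).
Proof.
move=> hs_inj hs0.
pose P (h : {ffun 'I_N -> nat}) : {poly C} := \prod_(n < N) ('X - (pt n (h n))%:P).
have PE h x : (P h).[x] = \prod_(n < N) (x - pt n (h n)).
  by rewrite horner_prod; apply: eq_bigr => n _; rewrite hornerXsubC.
have P_inj i j : i != j -> P (hs i) - P (hs j) != 0.
  apply: contra_neq => /eqP; rewrite subr_eq0 => /eqP Pij; apply: hs_inj; apply/ffunP => n.
  have := PE (hs j) (pt n (hs i n)); rewrite -Pij PE (bigD1 n) //= subrr mul0r.
  move/esym/eqP; rewrite prodf_seq_eq0 => /hasP [m _] /=.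
  by rewrite subr_eq0 xik_eq => /andP [/eqP <- /eqP].
(* A non-root of Q is a value of mu which separates the eigenvalues and is fresh for every label. *)
pose Q : {poly C} := (\prod_(i < p) \prod_(j < p | i != j) (P (hs i) - P (hs j))) *
  \prod_(i < p) \prod_(m < N) \prod_(k < hs i m) ('X - (pt m k)%:P).
have [mu] : exists mu, Q.[mu] != 0.
  apply: poly_nonroot; rewrite mulf_neq0 //; apply/prodf_neq0 => i _; apply/prodf_neq0 => j.
    exact: P_inj.
  by move=> _; apply/prodf_neq0 => k _; rewrite polyXsubC_eq0.
rewrite hornerM !horner_prod mulf_eq0 negb_or => /andP [/prodf_neq0 mu1 /prodf_neq0 mu2].
apply: (@eigenvectors_row_free _ _ _ _ (mono mu 0 1)
  (fun i => K 0 1 * \prod_(n < N) (mu - pt n (hs i n)))).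
- move=> i j /(mulfI K01) /eqP; rewrite -!PE -subr_eq0; apply: contraTeq => ij.
  have := mu1 i isT; rewrite horner_prod => /prodf_neq0 /(_ j ij).
  by rewrite hornerD hornerN.
- move=> i; rewrite rowK ladder_B // => m k km.
  have := mu2 i isT; rewrite horner_prod => /prodf_neq0 /(_ m isT).
  rewrite horner_prod => /prodf_neq0 /(_ (Ordinal km) isT).
  by rewrite hornerXsubC subr_eq0.
- by move=> i; rewrite rowK.
Qed.

Definition label (c : config) : {ffun 'I_N -> nat} := [ffun n => c n : nat].

Lemma label_inj : injective label.
Proof.
by move=> c c' /ffunP e; apply/ffunP => n; apply: val_inj; have := e n; rewrite !ffunE.
Qed.

Lemma label_le c n : (label c n <= tws n)%N.
Proof. by rewrite ffunE -ltnS. Qed.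

Definition ladder_mx : 'M[C]_#|{: config}| := \matrix_i ladder (label (enum_val i)).

Lemma ladder_mx_unit : ladder_mx \in unitmx.
Proof.
rewrite -row_free_unit; apply: (ladders_row_free (hs := fun i => label (enum_val i))).
  by move=> i j /label_inj /enum_val_inj.
by move=> i; apply: ladder_neq0 => n; apply: label_le.
Qed.

(* Otherwise this covector and the ladder basis would be dim H + 1 eigenvectors
   of B(mu) with distinct eigenvalues. *)
Lemma ladder_top (h : {ffun 'I_N -> nat}) n : h n = (tws n).+1 -> ladder h = 0.
Proof.
move=> hn; apply/eqP; apply/negPn/negP => h0.
pose D := #|{: config}|.
pose hs (i : 'I_D.+1) := if unlift ord0 i is Some j then label (enum_val j) else h.
have neq c : label c != h.
  by apply/eqP => /ffunP /(_ n) E; have := label_le c n; rewrite E hn ltnn.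
have: row_free (\matrix_i ladder (hs i)).
  apply: ladders_row_free => [i j|i]; rewrite /hs.
    case: unliftP => [i' ->|->]; case: unliftP => [j' ->|->] //.
    - by move/label_inj/enum_val_inj => ->.
    - by move/eqP; rewrite (negPf (neq _)).
    - by move/esym/eqP; rewrite (negPf (neq _)).
  case: unliftP => [j _|_] //.
  by apply: ladder_neq0 => m; apply: label_le.
by move/eqP => rk; have := rank_leq_col (\matrix_i ladder (hs i)); rewrite rk ltnn.
Qed.

Local Notation fus n := (@fused C N tws eta xi K (pt n 0)).

Definition with_label (h : {ffun 'I_N -> nat}) n l : {ffun 'I_N -> nat} :=
  [ffun m => if m == n then l else h m].

Lemma with_labelS h n l : with_label h n l.+1 = raise n (with_label h n l).
Proof.
by apply/ffunP => m; rewrite !ffunE; case: eqP => _; rewrite ?addn1 ?addn0.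
Qed.

Lemma with_label_id (h : {ffun 'I_N -> nat}) n : with_label h n (h n) = h.
Proof. by apply/ffunP => m; rewrite !ffunE; case: eqP => // ->. Qed.

(** Each step applies T = A + D: A raises the label, and D gives a quantum determinant times the
    previous covector, which is exactly the term subtracted in [fused_recr]. In the initial step D
    vanishes by [ladder_D0]. *)
Lemma ladder_fused (h : {ffun 'I_N -> nat}) n l : h n = 0%N ->
  ladder h *m fus n l 0 = ladder (with_label h n l).
Proof.
move=> hn.
have trE k (v : 'rV_#|{: config}|) :
    v *m tr1 (pt n 0 - k%:R * eta) = v *m opA (pt n k) + v *m mono (pt n k) 1 1.
  by rewrite -xikE /transfer1 /mxtrace big_ord2 mulmxDr.
have h0 : with_label h n 0 = h by rewrite -[in RHS](with_label_id h n) hn.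
have wl k : with_label h n k n = k by rewrite ffunE eqxx.
have E1 : ladder h *m fus n 1 0 = ladder (with_label h n 1).
  rewrite /fused /= trE ladder_D0 // addr0 with_labelS h0.
  by rewrite ladder_raise hn.
suff: ladder h *m fus n l 0 = ladder (with_label h n l) /\
  ladder h *m fus n l.+1 0 = ladder (with_label h n l.+1) by case.
elim: l => [|l [IH IH']]; first by rewrite h0 /fused /= mulmx1.
split=> //; rewrite fused_recr !add0n mulmxBr -scalemxAr mulmxA IH IH' trE.
rewrite -xikE (with_labelS h n l); have D := ladder_D (with_label h n l) n.
rewrite wl in D; rewrite D addrK -with_labelS.
by rewrite (with_labelS h n l.+1) ladder_raise wl.
Qed.

Lemma ladder_prod_fused h : ladder h = bra0 *m \prod_(n < N) fus n (h n) 0.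
Proof.
have H (r : seq 'I_N) (g : {ffun 'I_N -> nat}) : uniq r -> (forall n, n \in r -> g n = 0%N) ->
    ladder g *m \prod_(n <- r) fus n (h n) 0 =
    ladder [ffun m => if m \in r then h m else g m].
  elim: r g => [|n r IH] g /=.
    move=> _ _; rewrite big_nil mulmx1; congr ladder.
    by apply/ffunP => m; rewrite ffunE.
  case/andP=> nr ur g0; rewrite big_cons -mulmxE mulmxA ladder_fused ?g0 ?mem_head //.
  rewrite IH // => [|m mr].
    congr ladder; apply/ffunP => m; rewrite !ffunE inE.
    by case: (eqVneq m n) => [->|//]; rewrite (negPf nr).
  rewrite ffunE; case: eqP => [mn|_]; first by rewrite mn (negPf nr) in mr.
  by rewrite g0 // inE mr orbT.
rewrite -ladder0 H ?index_enum_uniq //; last by move=> n _; rewrite ffunE.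
by congr ladder; apply/ffunP => m; rewrite ffunE mem_index_enum.
Qed.

Lemma fused_closed n : fus n (tws n).+1 0 = 0.
Proof.
apply: (can_inj (mulKmx ladder_mx_unit)); rewrite mulmx0; apply/row_matrixP => i.
rewrite row_mul rowK row0; set h := label _.
(* Resetting site n to 0 lets the long window be commuted to the front, where it produces the
   covector of [ladder_top]. *)
have -> : ladder h = ladder (with_label h n 0) *m fus n (h n) 0.
  rewrite ladder_fused ?ffunE ?eqxx //; congr ladder; apply/ffunP => m.
  by rewrite !ffunE; case: eqP => // ->.
rewrite -mulmxA [_ *m fus n _ 0]fused_comm -mulmxE mulmxA ladder_fused ?ffunE ?eqxx //.
by rewrite (@ladder_top _ n) ?mul0mx // ffunE eqxx.
Qed.

Transparent monodromy.
End Sklyanin.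

(** * Covariance under rotations *)

Section SymmetricTensors.

Variables (C : numClosedFieldType) (l : nat).
Local Notation wmx := 'M[C]_#|{: word l}|.
Local Notation sb := (@sym_basis C l).

Definition wtensor (X : 'I_l -> 'M[C]_2) : wmx :=
  \matrix_(i, j) \prod_(k < l) X k ((enum_val i : word l) k) ((enum_val j : word l) k).

Lemma wtensorM X Y : wtensor X *m wtensor Y = wtensor (fun k => X k *m Y k).
Proof.
apply/matrixP=> i j; rewrite !mxE.
transitivity (\sum_(w : word l) \prod_(k < l)
   (X k ((enum_val i : word l) k) (w k) * Y k (w k) ((enum_val j : word l) k))).
  rewrite [RHS]big_enum_val /=; apply: eq_bigr => k _.
  by rewrite !mxE -big_split.
rewrite -(bigA_distr_bigA (fun k x => X k ((enum_val i : word l) k) x *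
   Y k x ((enum_val j : word l) k))).
by apply: eq_bigr => n _; rewrite mxE.
Qed.

Lemma eq_wtensor X Y : (forall k, X k = Y k) -> wtensor X = wtensor Y.
Proof.
by move=> eXY; apply/matrixP=> i j; rewrite !mxE; apply: eq_bigr => n _; rewrite eXY.
Qed.

Lemma tensor_powerM (W W' : 'M[C]_2) :
  tensor_power l (W *m W') = tensor_power l W *m tensor_power l W'.
Proof. by rewrite [RHS](wtensorM (fun=> W) (fun=> W')). Qed.

Lemma tensor_power1 : tensor_power l (1%:M : 'M[C]_2) = 1%:M.
Proof.
apply/matrixP=> i j; rewrite !mxE -(inj_eq enum_val_inj).
case: eqP => [->|neq]; first by rewrite big1 // => n _; rewrite mxE eqxx.
have /existsP [n nn] : [exists n, (enum_val i : word l) n != (enum_val j : word l) n].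
  apply: contra_notT neq; rewrite negb_exists => /forallP eqn; apply/ffunP => n.
  by move/negPn/eqP: (eqn n).
by rewrite (bigD1 n) //= mxE (negPf nn) mul0r.
Qed.

Definition one_slot (E X : 'M[C]_2) (k i : 'I_l) := if i == k then E else X.

(** Derivative of [tensor_power] at the identity in the direction E. *)
Definition dtensor (E : 'M[C]_2) : wmx := \sum_k wtensor (one_slot E 1%:M k).

(** Equivariance under F -> W F W^-1, written with F = E W so that no inverse appears. *)
Lemma tensor_power_dtensor (W E : 'M[C]_2) :
  tensor_power l W *m dtensor (E *m W) = dtensor (W *m E) *m tensor_power l W.
Proof.
rewrite /dtensor mulmx_sumr mulmx_suml; apply: eq_bigr => k _.
rewrite [LHS](wtensorM (fun=> W)) [RHS](wtensorM _ (fun=> W)).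
apply: eq_wtensor => i; rewrite /one_slot; case: eqP => _; first by rewrite mulmxA.
by rewrite mulmx1 mul1mx.
Qed.

Lemma binC_neq0 (j : 'I_l.+1) : ('C(l, j)%:R : C) != 0.
Proof. by rewrite pnatr_eq0 -lt0n bin_gt0 -ltnS. Qed.

Lemma sum_ones (f : nat -> C) (j : 'I_l.+1) :
  \sum_(w : word l) ((ones w == j)%:R * f (ones w)) = 'C(l, j)%:R * f j.
Proof.
transitivity (\sum_(w : word l | ones w == j) f j).
  rewrite [RHS]big_mkcond; apply: eq_bigr => w _.
  by case: eqP => [->|_]; rewrite ?mul1r ?mul0r.
rewrite sumr_const (eq_card (B := [pred w : word l | ones w == j])) // card_ones.
by rewrite -(mulr_natl (f j)).
Qed.

Lemma sym_basis_orthonormal : sb^T *m sb = 1%:M.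
Proof.
apply/matrixP=> j j'; rewrite [LHS]mxE [RHS]mxE.
transitivity (\sum_(w : word l) ((ones w == j)%:R *
    ((sqrtC 'C(l, j)%:R)^-1 * ((ones w == j')%:R * (sqrtC 'C(l, j')%:R)^-1)) : C)).
  rewrite [RHS]big_enum_val /=; apply: eq_bigr => k _.
  by rewrite [X in X * _]mxE !sym_basisE mulrA.
rewrite (sum_ones (fun a => (sqrtC 'C(l, j)%:R)^-1 * ((a == j')%:R * (sqrtC 'C(l, j')%:R)^-1))).
rewrite -(inj_eq val_inj) /=; case: eqP => [->|_]; last by rewrite mul0r !mulr0.
by rewrite mul1r -expr2 exprVn sqrtCK mulfV ?binC_neq0.
Qed.

(** Such columns are symmetric tensors, on which the projector sb sb^T is the identity. *)
Lemma sym_basis_coords p (X : 'M[C]_(#|{: word l}|, p)) (f : nat -> 'I_p -> C) :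
  (forall i j, X i j = f (ones (enum_val i : word l)) j) -> sb *m (sb^T *m X) = X.
Proof.
move=> Xf; apply/matrixP=> i c; rewrite mxE.
have E j : (sb^T *m X) j c = (sqrtC 'C(l, j)%:R)^-1 * ('C(l, j)%:R * f j c).
  rewrite mxE -(sum_ones (f^~ c)) mulr_sumr [RHS]big_enum_val /=; apply: eq_bigr => k _.
  by rewrite [X in X * _]mxE sym_basisE Xf mulrAC mulrC.
have ol : (ones (enum_val i : word l) < l.+1)%N by rewrite ltnS ones_le.
rewrite (bigD1 (Ordinal ol)) //= big1 => [|j jo].
  rewrite E sym_basisE eqxx mul1r addr0 !mulrA -expr2 exprVn sqrtCK.
  by rewrite mulVf ?mul1r ?(binC_neq0 (Ordinal ol)) // -Xf.
by move: jo; rewrite sym_basisE -val_eqE /= eq_sym => /negPf ->; rewrite !mul0r.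
Qed.

Lemma tensor_power_sym_basis (W : 'M[C]_2) :
  tensor_power l W *m sb = sb *m spin_rep l W.
Proof.
rewrite /spin_rep -mulmxA; apply/esym.
(* The entries of W commute, so a constant sequence satisfies the quantum determinant relation and
   [row_coef_word] shows that W acts within symmetric tensors. The transpose is there because
   [row_coef_word] sums over row words. *)
have WW : forall k : nat, qdet_rel W^T W^T (\det W).
  move=> _ i k; rewrite !mxE det_mx22.
  by case: (ord2_cases i) => ->; case: (ord2_cases k) => -> /=; ring.
apply: (sym_basis_coords (f := fun a (j : 'I_l.+1) =>
   row_coef (fun=> W^T) 0 (sorted_word (l - a) a) j * (sqrtC 'C(l, j)%:R)^-1)) => i j.
rewrite -(row_coef_word _ _ WW) mxE mulr_suml.
rewrite [RHS]big_mkcond [RHS]big_enum_val /=; apply: eq_bigr => k _.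
rewrite sym_basisE mxE mulrCA; case: eqP => _; last by rewrite mul0r.
by rewrite mul1r; congr (_ * _); apply: eq_bigr => s _; rewrite mxE.
Qed.

Lemma spin_repM (W W' : 'M[C]_2) : spin_rep l (W *m W') = spin_rep l W *m spin_rep l W'.
Proof.
rewrite {1}/spin_rep tensor_powerM -!mulmxA tensor_power_sym_basis.
by rewrite [tensor_power l W *m (_ *m _)]mulmxA tensor_power_sym_basis !mulmxA
  sym_basis_orthonormal mul1mx.
Qed.

Lemma spin_rep_unit (W : 'M[C]_2) : W \in unitmx -> spin_rep l W \in unitmx.
Proof.
move=> Wu; apply: (proj1 (mulmx1_unit (B := spin_rep l (invmx W)) _)).
by rewrite -spin_repM mulmxV // /spin_rep tensor_power1 mulmx1 sym_basis_orthonormal.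
Qed.

(* The shift makes gl2_gen i j the exact image of E_ji, so that dspin is the
   derivative of spin_rep at the identity. *)
Definition dspin (E : 'M[C]_2) : 'M[C]_l.+1 :=
  \sum_i \sum_j E j i *: (gl2_gen C l i j + ((l%:R / 2 - 2^-1) * (i == j)%:R)%:M).

Lemma dspinE (E : 'M[C]_2) (i j : 'I_l.+1) : dspin E i j =
  ((l - i)%:R * E 0 0 + i%:R * E 1 1) * (i == j)%:R +
  (E 0 1 * (if j == i.+1 :> nat then sqrtC (i.+1 * (l - i))%:R else 0) +
   E 1 0 * (if i == j.+1 :> nat then sqrtC (j.+1 * (l - j))%:R else 0)).
Proof.
rewrite /dspin !big_ord2 !mxE /= !mulr1 !mulr0 !mul0rn.
have il : (i <= l)%N by rewrite -ltnS.
case: (eqVneq i j) => [<-|_]; rewrite ?mulr1n ?mulr0n natrB //; first by field.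
by ring.
Qed.

Definition replace (w : word l) (k : 'I_l) (x : 'I_2) : word l :=
  [ffun i => if i == k then x else w i].

Lemma ones_replace w k x : (ones (replace w k x) + (w k == 1%R) = ones w + (x == 1%R))%N.
Proof.
rewrite !onesE (bigD1 k) //= [in RHS](bigD1 k) //= ffunE eqxx.
rewrite (eq_bigr (fun i => (w i == 1%R) : nat)) => [|i /negPf ik]; last by rewrite ffunE ik.
by rewrite addnAC [RHS]addnAC; congr (_ + _)%N; rewrite addnC.
Qed.

Lemma sum_one_slot (E : 'M[C]_2) (w : word l) k (f : word l -> C) :
  \sum_(w' : word l) (\prod_i one_slot E 1%:M k i (w i) (w' i)) * f w' =
  \sum_x E (w k) x * f (replace w k x).
Proof.
rewrite (bigID (fun w' : word l => [forall i, (i != k) ==> (w i == w' i)])) /=.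
rewrite [X in _ + X]big1 ?addr0 => [|w']; last first.
  case/forallPn => i; rewrite negb_imply => /andP [ik wi].
  by rewrite (bigD1 i) //= /one_slot (negPf ik) mxE (negPf wi) !mul0r.
rewrite (reindex (replace w k)) /=; last first.
  exists (fun w' : word l => w' k) => [x _|w' /forallP ww]; first by rewrite ffunE eqxx.
  apply/ffunP => i; rewrite ffunE; case: (eqVneq i k) => [->//|ik].
  by apply/eqP; have := ww i; rewrite ik.
apply: eq_big => [x|x _]; first by apply/forallP => i; apply/implyP => ik; rewrite ffunE (negPf ik).
congr (_ * _); rewrite (bigD1 k) //= {1}/one_slot eqxx ffunE eqxx big1 ?mulr1 // => i ik.
by rewrite /one_slot (negPf ik) ffunE (negPf ik) mxE eqxx.
Qed.

Lemma sqrtC_natM a b : sqrtC (a * b)%:R = sqrtC a%:R * sqrtC b%:R :> C.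
Proof. by rewrite natrM sqrtCM ?qualifE /= ?ler0n. Qed.

Lemma sqrtC_bin (o : nat) :
  sqrtC o.+1%:R * sqrtC 'C(l, o.+1)%:R = sqrtC (l - o)%:R * sqrtC 'C(l, o)%:R :> C.
Proof. by rewrite -!sqrtC_natM mul_bin_left. Qed.

Lemma sqrtC_bin_neq0 (o : nat) : (o <= l)%N -> sqrtC 'C(l, o)%:R != 0 :> C.
Proof. by move=> ol; rewrite sqrtC_eq0 (binC_neq0 (Ordinal (ol : (o < l.+1)%N))). Qed.

(** The number l - o of letters 0 that can become 1, corrected by the change of normalization, is
    the entry of [spin_plus]; [sqrt_bin_down] is the reverse count. *)
Lemma sqrt_bin_up (o : nat) : (o < l)%N ->
  (l - o)%:R * (sqrtC 'C(l, o.+1)%:R)^-1 =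
  (sqrtC 'C(l, o)%:R)^-1 * sqrtC (o.+1 * (l - o))%:R :> C.
Proof.
move=> ol; rewrite sqrtC_natM -[X in X * _ = _]sqrtCK expr2.
have := sqrtC_bin_neq0 ol; have := sqrtC_bin_neq0 (ltnW ol); have := sqrtC_bin o.
move: (sqrtC o.+1%:R) (sqrtC (l - o)%:R) (sqrtC 'C(l, o)%:R) (sqrtC 'C(l, o.+1)%:R).
move=> p r P Q E P0 Q0; apply: (mulfI P0); rewrite mulVKf // [p * r]mulrC.
by apply: (mulIf Q0); rewrite !mulrA mulfVK // -[RHS]mulrA E; ring.
Qed.

Lemma sqrt_bin_down (o : nat) : (o < l)%N ->
  o.+1%:R * (sqrtC 'C(l, o)%:R)^-1 =
  (sqrtC 'C(l, o.+1)%:R)^-1 * sqrtC (o.+1 * (l - o))%:R :> C.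
Proof.
move=> ol; rewrite sqrtC_natM -[X in X * _ = _]sqrtCK expr2.
have := sqrtC_bin_neq0 ol; have := sqrtC_bin_neq0 (ltnW ol); have := sqrtC_bin o.
move: (sqrtC o.+1%:R) (sqrtC (l - o)%:R) (sqrtC 'C(l, o)%:R) (sqrtC 'C(l, o.+1)%:R).
move=> p r P Q E P0 Q0; apply: (mulfI Q0); rewrite mulVKf //.
by apply: (mulIf P0); rewrite !mulrA mulfVK // -[RHS]mulrA -E; ring.
Qed.

(** Here the explicit spin matrices meet symmetric tensors: E replaces one letter at a time, and the
    letters 1 and 0 of the word are counted separately. *)
Lemma dtensor_sym_basis (E : 'M[C]_2) : dtensor E *m sb = sb *m dspin E.
Proof.
apply/matrixP=> i j; set w : word l := enum_val i.
pose c a : C := (sqrtC 'C(l, a)%:R)^-1.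
pose g a : C := (a == j :> nat)%:R * c j.
have -> : (dtensor E *m sb) i j = \sum_k \sum_x E (w k) x * g (ones (replace w k x)).
  rewrite mxE.
  transitivity (\sum_(w' : word l) \sum_k
      (\prod_s one_slot E 1%:M k s (w s) (w' s)) * g (ones w')).
    rewrite [RHS]big_enum_val /=; apply: eq_bigr => k _.
    rewrite summxE sym_basisE mulr_suml; apply: eq_bigr => s _.
    by rewrite mxE.
  rewrite exchange_big /=; apply: eq_bigr => k _.
  exact: (sum_one_slot E w k (fun w' => g (ones w'))).
have ol : (ones w < l.+1)%N by rewrite ltnS ones_le.
set o := Ordinal ol.
have -> : (sb *m dspin E) i j = c (ones w) * dspin E o j.
  rewrite mxE (bigD1 o) //= big1 => [|k ko].
    by rewrite sym_basisE eqxx mul1r addr0.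
  by move: ko; rewrite sym_basisE -val_eqE /= eq_sym => /negPf ->; rewrite !mul0r.
(* The predecessor [(ones w).-1] is weighted by the letters equal to 1, so its value at 0 is
   harmless. *)
have -> : \sum_k \sum_x E (w k) x * g (ones (replace w k x)) =
    \sum_k ((w k == 1)%:R * (E 1 0 * g (ones w).-1 + E 1 1 * g (ones w)) +
            (1 - (w k == 1)%:R) * (E 0 0 * g (ones w) + E 0 1 * g (ones w).+1)).
  apply: eq_bigr => k _; rewrite big_ord2.
  have := ones_replace w k 0; have := ones_replace w k 1.
  case: (ord2_cases (w k)) => -> /=; rewrite ?addn0 ?addn1.
    by move=> -> ->; rewrite mul0r add0r subr0 mul1r.
  by move=> [->] <-; rewrite subrr mul0r addr0 mul1r.
rewrite big_split -!mulr_suml sumrB /= -!natr_sum -onesE sumr_const card_ord -natrB ?ones_le //.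
rewrite dspinE /g /c /= (_ : (o == j) = (ones w == j :> nat)) //.
clear o; move: (ones w) ol => m ml.
have e0 : (m == j :> nat)%:R / sqrtC 'C(l, j)%:R =
    (sqrtC 'C(l, m)%:R)^-1 * (m == j :> nat)%:R :> C.
  by case: eqP => [->|_]; rewrite ?mulr1 ?mul1r ?mulr0 ?mul0r.
have e1 : (l - m)%:R * ((m.+1 == j)%:R / sqrtC 'C(l, j)%:R) =
    (sqrtC 'C(l, m)%:R)^-1 * (if j == m.+1 :> nat then sqrtC (m.+1 * (l - m))%:R else 0) :> C.
  rewrite eq_sym; case: eqP => [jm|_]; last by rewrite !(mulr0, mul0r).
  by rewrite mul1r jm sqrt_bin_up // -ltnS -jm.
have e2 : m%:R * ((m.-1 == j)%:R / sqrtC 'C(l, j)%:R) =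
    (sqrtC 'C(l, m)%:R)^-1 * (if m == j.+1 :> nat then sqrtC (j.+1 * (l - j))%:R else 0) :> C.
  case: m ml {e0 e1} => [|m] ml; first by rewrite mul0r mulr0.
  rewrite eqSS /=; case: eqP => [<-|_]; last by rewrite !(mulr0, mul0r).
  by rewrite mul1r sqrt_bin_down.
transitivity (E 1 0 * (m%:R * ((m.-1 == j)%:R / sqrtC 'C(l, j)%:R)) +
  E 0 1 * ((l - m)%:R * ((m.+1 == j)%:R / sqrtC 'C(l, j)%:R)) +
  ((l - m)%:R * E 0 0 + m%:R * E 1 1) * ((m == j :> nat)%:R / sqrtC 'C(l, j)%:R)).
  by ring.
by rewrite e0 e1 e2; ring.
Qed.

Lemma spin_rep_dspin (W E : 'M[C]_2) :
  spin_rep l W *m dspin (E *m W) = dspin (W *m E) *m spin_rep l W.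
Proof.
have sb_inj (X Y : 'M[C]_l.+1) : sb *m X = sb *m Y -> X = Y.
  move/(congr1 (mulmx sb^T)); by rewrite !mulmxA sym_basis_orthonormal !mul1mx.
apply: sb_inj.
rewrite mulmxA -tensor_power_sym_basis -mulmxA -(dtensor_sym_basis (E *m W)) mulmxA.
by rewrite tensor_power_dtensor -mulmxA tensor_power_sym_basis !mulmxA dtensor_sym_basis.
Qed.

(** [spin_rep_dspin] for a matrix unit; the diagonal shifts of [dspin] contribute the same multiple
    of [spin_rep l W] to both sides. *)
Lemma spin_rep_gl2_gen (W : 'M[C]_2) c b :
  \sum_a W c a *: (spin_rep l W *m gl2_gen C l a b) =
  \sum_d W d b *: (gl2_gen C l c d *m spin_rep l W).
Proof.
set kappa : C := l%:R / 2 - 2^-1.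
have El : dspin (delta_mx b c *m W) =
    \sum_a W c a *: (gl2_gen C l a b + (kappa * (a == b)%:R)%:M).
  apply: eq_bigr => a _; rewrite (bigD1 b) //= big1 => [|j /negPf jb].
    rewrite addr0 [X in X *: _](_ : _ = W c a) // mxE (bigD1 c) //= mxE !eqxx mul1r.
    by rewrite big1 ?addr0 // => k /negPf kc; rewrite mxE kc andbF mul0r.
  rewrite mxE big1 ?scale0r // => k _.
  by rewrite mxE jb mul0r.
have Er : dspin (W *m delta_mx b c) =
    \sum_d W d b *: (gl2_gen C l c d + (kappa * (c == d)%:R)%:M).
  rewrite /dspin (bigD1 c) //= [X in _ + X]big1 => [|i /negPf ic].
    rewrite addr0; apply: eq_bigr => d _; congr (_ *: _).
    rewrite mxE (bigD1 b) //= mxE !eqxx mulr1 big1 ?addr0 // => k /negPf kb.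
    by rewrite mxE kb mulr0.
  rewrite big1 // => j _; rewrite mxE big1 ?scale0r // => k _.
  by rewrite mxE ic andbF mulr0.
have := spin_rep_dspin W (delta_mx b c); rewrite El Er mulmx_sumr mulmx_suml.
have -> : \sum_a spin_rep l W *m (W c a *: (gl2_gen C l a b + (kappa * (a == b)%:R)%:M)) =
    \sum_a W c a *: (spin_rep l W *m gl2_gen C l a b) + (kappa * W c b) *: spin_rep l W.
  transitivity (\sum_a (W c a *: (spin_rep l W *m gl2_gen C l a b) +
      (kappa * (W c a * (a == b)%:R)) *: spin_rep l W)).
    apply: eq_bigr => a _; rewrite -scalemxAr mulmxDr scalerDr mul_mx_scalar scalerA.
    by rewrite mulrCA.
  rewrite big_split /= -scaler_suml -mulr_sumr; congr (_ + (_ * _) *: _).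
  rewrite (bigD1 b) //= eqxx mulr1.
  by rewrite big1 ?addr0 // => a /negPf ->; rewrite mulr0.
have -> : \sum_d W d b *: (gl2_gen C l c d + (kappa * (c == d)%:R)%:M) *m spin_rep l W =
    \sum_d W d b *: (gl2_gen C l c d *m spin_rep l W) + (kappa * W c b) *: spin_rep l W.
  transitivity (\sum_d (W d b *: (gl2_gen C l c d *m spin_rep l W) +
      (kappa * (W d b * (c == d)%:R)) *: spin_rep l W)).
    apply: eq_bigr => d _; rewrite -scalemxAl mulmxDl scalerDr mul_scalar_mx scalerA.
    by rewrite mulrCA.
  rewrite big_split /= -scaler_suml -mulr_sumr; congr (_ + (_ * _) *: _).
  rewrite (bigD1 c) //= eqxx mulr1.
  by rewrite big1 ?addr0 // => d; rewrite eq_sym => /negPf ->; rewrite mulr0.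
by move/addIr.
Qed.

End SymmetricTensors.

(** * GL_2 covariance of monodromy and fused transfer matrices *)

Section Covariance.

Variables (C : numClosedFieldType) (N : nat) (tws : 'I_N -> nat).
Variables (eta : C) (xi : 'I_N -> C) (W : 'M[C]_2) (W_unit : W \in unitmx).
Local Notation config := (config tws).
Local Notation opH := 'M[C]_#|{: config}|.
Local Notation lax := (@lax C N tws eta).
Local Notation lift := (@lift_op C N tws 2 2).

Definition rot : opH := tensor_op (fun n => spin_rep (tws n) W).

Lemma rot_unit : rot \in unitmx.
Proof. by apply: tensor_op_inv => n; apply: spin_rep_unit. Qed.

Definition conj_rot (X : 'M[opH]_2) : 'M[opH]_2 :=
  map_mx (fun x => rot *m x *m invmx rot) X.

Lemma conj_rotM X Y : conj_rot (X *m Y) = conj_rot X *m conj_rot Y.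
Proof.
apply/matrixP=> i j; rewrite !mxE mulmx_sumr mulmx_suml; apply: eq_bigr => k _.
by rewrite !mxE -!mulmxE !mulmxA mulmxKV ?rot_unit.
Qed.

Lemma conj_rot_lift X : conj_rot (lift X) = lift X.
Proof.
apply/matrixP=> i j; rewrite !mxE.
by rewrite scalar_mxC mulmxK // rot_unit.
Qed.

Lemma local_lax_covariant n lam c b :
  \sum_a W c a *: (spin_rep (tws n) W *m local_lax (tws n) eta lam a b) =
  \sum_d W d b *: (local_lax (tws n) eta lam c d *m spin_rep (tws n) W).
Proof.
transitivity ((W c b * lam) *: spin_rep (tws n) W +
   eta *: \sum_a W c a *: (spin_rep (tws n) W *m gl2_gen C (tws n) a b)).
  rewrite scaler_sumr.
  transitivity (\sum_a ((W c a * (a == b)%:R * lam) *: spin_rep (tws n) W +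
     eta *: (W c a *: (spin_rep (tws n) W *m gl2_gen C (tws n) a b)))).
    apply: eq_bigr => a _; rewrite local_laxE mulmxDr scalerDr mul_mx_scalar.
    by rewrite -scalemxAr !scalerA mulrA [eta * _]mulrC.
  rewrite big_split /= -scaler_suml -mulr_suml; congr ((_ * _) *: _ + _).
  rewrite (bigD1 b) //= eqxx mulr1.
  by rewrite big1 ?addr0 // => a /negPf ->; rewrite mulr0.
rewrite spin_rep_gl2_gen scaler_sumr; apply/esym.
transitivity (\sum_d ((W d b * (c == d)%:R * lam) *: spin_rep (tws n) W +
   eta *: (W d b *: (gl2_gen C (tws n) c d *m spin_rep (tws n) W)))).
  apply: eq_bigr => d _; rewrite local_laxE mulmxDl scalerDr mul_scalar_mx.
  by rewrite -scalemxAl !scalerA mulrA [eta * _]mulrC.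
rewrite big_split /= -scaler_suml -mulr_suml; congr ((_ * _) *: _ + _).
rewrite (bigD1 c) //= eqxx mulr1.
by rewrite big1 ?addr0 // => a; rewrite eq_sym => /negPf ->; rewrite mulr0.
Qed.

Lemma rot_site n (X : 'M[C]_((tws n).+1)) :
  rot *m site X *m invmx rot = site (spin_rep (tws n) W *m X *m invmx (spin_rep (tws n) W)).
Proof.
rewrite (@site_conj _ _ _ n (fun n => spin_rep (tws n) W) _
  (spin_rep (tws n) W *m X *m invmx (spin_rep (tws n) W))).
  by rewrite mulmxK ?rot_unit.
by rewrite mulmxKV ?spin_rep_unit.
Qed.

Lemma site_sum n (I : finType) (F : I -> 'M[C]_((tws n).+1)) :
  site (\sum_i F i) = \sum_i site (F i).
Proof. exact: (big_morph _ (@siteD _ _ _ n) (@site0 _ _ _ n)). Qed.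

(** The Lax operator commutes with W acting simultaneously on the auxiliary and the quantum spaces;
    moving the quantum rotation to one side gives this form. *)
Lemma lax_covariant n lam : lift W *m conj_rot (lax n lam) = lax n lam *m lift W.
Proof.
set rho := spin_rep (tws n) W.
have rhoU : rho \in unitmx by apply: spin_rep_unit.
apply/matrixP=> c b.
transitivity (site (\sum_a W c a *: (rho *m local_lax (tws n) eta lam a b) *m invmx rho)).
  rewrite -mulmx_suml mulmx_suml site_sum mxE; apply: eq_bigr => a _.
  rewrite [X in X * _]mxE [X in _ * X]mxE laxE rot_site -mulmxE mul_scalar_mx.
  by rewrite -siteZ -scalemxAl.
rewrite -mulmx_suml local_lax_covariant mulmx_suml site_sum [RHS]mxE; apply: eq_bigr => d _.
rewrite [X in _ * X]mxE laxE -mulmxE mul_mx_scalar -scalemxAl siteZ mulmxK //.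
Qed.

Lemma prod_lax_covariant (r : seq 'I_N) (f : 'I_N -> C) (g : 'I_N -> 'I_N) :
  lift W *m conj_rot (\prod_(n <- r) lax (g n) (f n)) =
  (\prod_(n <- r) lax (g n) (f n)) *m lift W.
Proof.
elim: r => [|n r IH].
  rewrite !big_nil mul1mx -[X in conj_rot X](_ : lift 1%:M = _).
    by rewrite conj_rot_lift -lift_opM mulmx1.
  by rewrite /lift_op map_mx1.
by rewrite !big_cons -!mulmxE conj_rotM mulmxA lax_covariant -mulmxA IH mulmxA.
Qed.

Lemma monodromy_covariant K lam :
  conj_rot (monodromy tws eta xi (invmx W *m K *m W) lam) =
  lift (invmx W) *m monodromy tws eta xi K lam *m lift W.
Proof.
rewrite /monodromy conj_rotM conj_rot_lift !lift_opM -!mulmxA.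
by rewrite prod_lax_covariant.
Qed.

Lemma mxtrace_lift X (Y : 'M[opH]_2) : \tr (lift X *m Y) = \tr (Y *m lift X).
Proof.
rewrite /mxtrace; under eq_bigr do rewrite mxE.
under [RHS]eq_bigr do rewrite mxE.
rewrite exchange_big /=; apply: eq_bigr => i _; apply: eq_bigr => j _.
by rewrite !mxE central_scalar.
Qed.

Lemma transfer1_covariant K lam :
  rot *m transfer1 tws eta xi (invmx W *m K *m W) lam *m invmx rot =
  transfer1 tws eta xi K lam.
Proof.
transitivity (\tr (conj_rot (monodromy tws eta xi (invmx W *m K *m W) lam))).
  by rewrite /transfer1 /mxtrace mulmx_sumr mulmx_suml; apply: eq_bigr => i _; rewrite [RHS]mxE.
rewrite monodromy_covariant -mulmxA mxtrace_lift -mulmxA -lift_opM mulmxV //.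
by rewrite /lift_op map_mx1 mulmx1.
Qed.

(** A continuant is built from transfer matrices, which are conjugated, and from quantum
    determinants, where K enters through det K. *)
Lemma fused_covariant K x l k :
  rot *m fused tws eta xi (invmx W *m K *m W) x l k *m invmx rot = fused tws eta xi K x l k.
Proof.
set K' := invmx W *m K *m W.
have dK : \det K' = \det K.
  have W0 : \det W != 0 by rewrite -unitfE -unitmxE.
  by rewrite /K' !det_mulmx det_inv mulrAC mulVf // mul1r.
suff: forall k, rot *m fused tws eta xi K' x l k *m invmx rot = fused tws eta xi K x l k /\
    rot *m fused tws eta xi K' x l.+1 k *m invmx rot = fused tws eta xi K x l.+1 k.
  by move/(_ k) => [].
elim: l {k} => [|l IH] k.
  rewrite /fused /= transfer1_covariant; split=> //.
  by rewrite mulmx1 mulmxV ?rot_unit.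
have [_ E] := IH k; split=> //.
rewrite !fused_recr -E -(IH k).1 -(transfer1_covariant K) mulmxBr mulmxBl.
rewrite -scalemxAr -scalemxAl /qdet_at dK; congr (_ - _).
by rewrite !mulmxA mulmxKV ?rot_unit.
Qed.

End Covariance.

(** * Separation bases *)

Section SeparationBasis.

Variables (C : numClosedFieldType) (N : nat) (tws : 'I_N -> nat).
Variables (eta : C) (eta0 : eta != 0).
Local Notation config := (config tws).
Local Notation opH := 'M[C]_#|{: config}|.
Local Notation covec := 'rV[C]_#|{: config}|.

Lemma prod_scale_mx n (I : eqType) (r : seq I) (a : I -> C) (F : I -> 'M[C]_n) :
  \prod_(i <- r) (a i *: F i) = (\prod_(i <- r) a i) *: \prod_(i <- r) F i.
Proof.
elim: r => [|i r IH]; first by rewrite !big_nil scale1r.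
by rewrite !big_cons IH -!mulmxE -scalemxAl -scalemxAr scalerA.
Qed.

Definition covec_mx (v : config -> covec) : opH := \matrix_i v (enum_val i).

Lemma covec_mx_basis v : covec_mx v \in unitmx -> is_covec_basis v.
Proof.
move=> vu; rewrite /is_covec_basis basisEdim size_map -cardE dimvf /dim /= mul1n leqnn andbT.
apply/subvP => x _; rewrite -(mulmxKV vu x) mulmx_sum_row memv_suml // => i _.
by rewrite memvZ // rowK memv_span // map_f // mem_enum.
Qed.

Lemma covec_mx_scale (c : config -> C) (v w : config -> covec) :
  (forall h, c h != 0) -> (forall h, v h = c h *: w h) ->
  (covec_mx v \in unitmx) = (covec_mx w \in unitmx).
Proof.
move=> c0 vw; have -> : covec_mx v = diag_mx (\row_i c (enum_val i)) *m covec_mx w.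
  by apply/row_matrixP => i; rewrite rowK mul_diag_mx; apply/rowP => k; rewrite vw !mxE.
rewrite !unitmxE det_mulmx det_diag unitrM unitfE.
by case: prodf_neq0 => // -[] i _; rewrite mxE.
Qed.

Variables (xi : 'I_N -> C) (adm : admissible tws eta xi).
Local Notation pt := (@xik C N tws eta xi).
Local Notation afun := (@a_fun C N tws eta xi).
Local Notation dfun := (@d_fun C N tws eta xi).
Local Notation fus K n := (@fused C N tws eta xi K (pt n 0)).

(** The window is xi^(h+1), ..., xi^(2s); it is empty at h = 2s_n. *)
Lemma transfer_low K n h : (h <= tws n)%N ->
  transfer tws eta xi K (tws n - h) (pt n (tws n)) = fus K n (tws n - h) h.+1.
Proof.
rewrite leq_eqVlt => /orP [/eqP ->|hn]; first by rewrite subnn /fused.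
rewrite -(transfer_fused tws eta0 xi K (pt n 0) (tws n - h) h.+1) xikE.
by have -> : (h.+1 + (tws n - h).-1)%N = tws n by lia.
Qed.

Lemma transfer_high K n h :
  transfer tws eta xi K h (pt n h.-1) = fus K n h 0.
Proof. by rewrite -(transfer_fused tws eta0 xi K (pt n 0) h 0) add0n xikE. Qed.

Variables (K : 'M[C]_2) (K_unit : K \in unitmx) (k1 k2 : C) (detK : \det K = k1 * k2).

Lemma k1k2_neq0 : (k1 != 0) && (k2 != 0).
Proof. by rewrite -negb_or -mulf_eq0 -detK -unitfE -unitmxE. Qed.

Definition coef_low n (h : nat) : C :=
  k2 ^ (h%:Z - (tws n)%:Z) / \prod_(k < tws n - h) dfun (pt n (tws n - k)).

Definition coef_high n (h : nat) : C := (k1 ^+ h * \prod_(k < h) afun (pt n k))^-1.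

Lemma sovE S (h : config) : sov eta xi K k2 S h =
  S *m \prod_(n < N) (coef_low n (h n) *: fus K n (tws n - h n) (h n).+1).
Proof.
by congr (_ *m _); apply: eq_bigr => n _; rewrite transfer_low // -ltnS.
Qed.

Lemma sov_from_originE O (h : config) : sov_from_origin eta xi K k1 O h =
  O *m \prod_(n < N) (coef_high n (h n) *: fus K n (h n) 0).
Proof. by congr (_ *m _); apply: eq_bigr => n _; rewrite transfer_high. Qed.

Lemma coef_low_neq0 n h : coef_low n h != 0.
Proof.
have /andP [_ k20] := k1k2_neq0.
rewrite mulf_neq0 ?invr_eq0 ?expfz_neq0 //; apply/prodf_neq0 => k _.
by apply: d_fun_neq0 => //; rewrite subn_gt0; apply: leq_trans (ltn_ord k) _; rewrite leq_subr.
Qed.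

Lemma coef_high_neq0 n h : (h <= tws n)%N -> coef_high n h != 0.
Proof.
have /andP [k10 _] := k1k2_neq0.
move=> hn; rewrite invr_eq0 mulf_neq0 ?expf_neq0 //; apply/prodf_neq0 => k _.
by apply: a_fun_neq0 => //; apply: leq_trans (ltn_ord k) hn.
Qed.

(** The quantum determinant at xi^(i) is k1 k2 a(xi^(i)) d(xi^(i+1)). Its factors k1 a cancel
    [coef_high], and its factors d remove xi^(1), ..., xi^(h) from the denominator of
    [coef_low n 0]. *)
Lemma coef_lowE n h : (h <= tws n)%N ->
  coef_low n h = coef_low n 0 * coef_high n h * \prod_(i < h) qdet_at tws eta xi K (pt n i).
Proof.
move=> hn; have /andP [k10 k20] := k1k2_neq0.
have a0 : \prod_(k < h) afun (pt n k) != 0.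
  by apply/prodf_neq0 => k _; apply: a_fun_neq0 => //; apply: leq_trans (ltn_ord k) hn.
have d0 : \prod_(i < h) dfun (pt n i.+1) != 0.
  by apply/prodf_neq0 => k _; apply: d_fun_neq0.
have -> : \prod_(i < h) qdet_at tws eta xi K (pt n i) =
    k1 ^+ h * k2 ^+ h * (\prod_(i < h) afun (pt n i) * \prod_(i < h) dfun (pt n i.+1)).
  rewrite -big_split -exprMn -[in (k1 * k2) ^+ h](card_ord h) -prodr_const -big_split.
  by apply: eq_bigr => i _; rewrite /qdet_at detK -xikS.
have dsplit : \prod_(k < tws n - 0) dfun (pt n (tws n - k)) =
    \prod_(k < tws n - h) dfun (pt n (tws n - k)) * \prod_(i < h) dfun (pt n i.+1).
  have split p (F : nat -> C) : \prod_(k < p + h) F k =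
      \prod_(k < p) F k * \prod_(i < h) F (p + i)%N by rewrite big_split_ord.
  have := split (tws n - h)%N (fun k => dfun (pt n (tws n - k))).
  rewrite subnK // subn0 => ->; congr (_ * _).
  rewrite (reindex_inj rev_ord_inj) /=; apply: eq_bigr => i _.
  by congr (dfun (pt n _)); have := ltn_ord i; lia.
have kE : k2 ^ (h%:Z - (tws n)%:Z) = k2 ^ (0%:Z - (tws n)%:Z) * k2 ^+ h.
  by rewrite sub0r addrC expfzDr.
rewrite /coef_low /coef_high dsplit kE.
have d0' : \prod_(k < tws n - h) dfun (pt n (tws n - k)) != 0.
  have := coef_low_neq0 n h; rewrite /coef_low mulf_eq0 negb_or invr_eq0.
  by case/andP.
have k1h : k1 ^+ h != 0 by rewrite expf_neq0.
move: (\prod_(k < _) _) (\prod_(k < _) _) (\prod_(k < _) _) a0 d0 d0' (k1 ^+ h) k1h.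
move=> x y z x0 y0 z0 u u0; field.
by rewrite x0 y0 z0 u0.
Qed.

(** Kept as a hypothesis: it is proved from the ladder basis when K_12 is nonzero, and transported
    by conjugation otherwise. *)
Hypothesis closed : forall n, fus K n (tws n).+1 0 = 0.

Lemma fused_low n h : (h <= tws n)%N ->
  fus K n (tws n) 1 *m fus K n h 0 =
  (\prod_(i < h) qdet_at tws eta xi K (pt n i)) *: fus K n (tws n - h) h.+1.
Proof.
case: h => [_|h hn]; first by rewrite big_ord0 scale1r subn0 mulmx1.
rewrite fused_euler // closed mul0mx add0r.
by congr (_ *: _); apply: eq_bigr => i _; rewrite -xikE.
Qed.

Lemma sov_sov_from_origin S (h : config) :
  sov eta xi K k2 S h = sov_from_origin eta xi K k1 (sov eta xi K k2 S config0) h.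
Proof.
rewrite sov_from_originE !sovE -mulmxA; congr (_ *m _).
rewrite mulmxE -prodrM_comm; last first.
  move=> i j _ _; rewrite /GRing.comm -!mulmxE -!scalemxAl -!scalemxAr !mulmxE fused_comm.
  by rewrite !scalerA mulrC.
apply: eq_bigr => n _; rewrite ffunE subn0 -mulmxE -scalemxAl -scalemxAr.
by rewrite fused_low -1?ltnS // !scalerA -coef_lowE // -ltnS.
Qed.

End SeparationBasis.

(** * Identification with Sklyanin's covectors *)

Section SklyaninIdentification.

Variables (C : numClosedFieldType) (N : nat) (tws : 'I_N -> nat).
Variables (eta : C) (eta0 : eta != 0).
Local Notation config := (config tws).
Local Notation covec := 'rV[C]_#|{: config}|.
Variables (xi : 'I_N -> C) (adm : admissible tws eta xi).
Local Notation pt := (@xik C N tws eta xi).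
Local Notation fus K n := (@fused C N tws eta xi K (pt n 0)).

Section OffDiagonal.
Variables (K : 'M[C]_2) (K_unit : K \in unitmx) (K01 : K 0 1 != 0).
Variables (k1 k2 : C) (detK : \det K = k1 * k2).

Lemma sklyanin_ladder (h : config) : sklyanin eta xi K k1 h =
  (\prod_(n < N) coef_high tws eta xi k1 n (h n)) *: ladder tws eta xi K (label h).
Proof.
rewrite /sklyanin /ladder [RHS]scalemxAr; congr (_ *m _).
rewrite -prod_scale_mx; apply: eq_bigr => n _; rewrite ffunE prod_scale_mx.
by rewrite prodfV big_split /= prodr_const card_ord.
Qed.

Lemma sklyanin_origin (h : config) :
  sklyanin eta xi K k1 h = sov_from_origin eta xi K k1 bra0 h.
Proof.
rewrite sklyanin_ladder sov_from_originE // prod_scale_mx -scalemxAr.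
congr (_ *: _); rewrite (ladder_prod_fused eta0 adm); congr (_ *m _).
by apply: eq_bigr => n _; rewrite ffunE.
Qed.

(** At h = 2s_n, [fused_low] makes the product of T^(2s|xi^(2s)) and T^(2s|xi^(2s-1)) a scalar: one
    climbs to the top label, the other descends to [bra0], and [coef_lowE] cancels the scalars. *)
Lemma sov_sklyanin0 :
  sov eta xi K k2 (sklyanin eta xi K k1 (@config_max N tws)) (@config0 N tws) = bra0.
Proof.
rewrite sklyanin_origin sov_from_originE // sovE // -mulmxA mulmxE -prodrM_comm; last first.
  move=> i j _ _; rewrite /GRing.comm -!mulmxE -!scalemxAl -!scalemxAr !mulmxE fused_comm.
  by rewrite !scalerA mulrC.
rewrite big1 ?mulmx1 // => n _; rewrite !ffunE subn0 -mulmxE -scalemxAl -scalemxAr /=.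
rewrite !mulmxE fused_comm -mulmxE fused_low //; last exact: fused_closed.
rewrite !scalerA [coef_high _ _ _ _ _ _ * _]mulrC -coef_lowE //.
by rewrite /coef_low subnn big_ord0 invr1 mulr1 subrr expr0z scale1r.
Qed.

Lemma sklyanin_sov (h : config) : sklyanin eta xi K k1 h =
  sov eta xi K k2 (sklyanin eta xi K k1 (@config_max N tws)) h.
Proof.
rewrite (sov_sov_from_origin eta0 adm K_unit detK); last exact: fused_closed.
by rewrite sov_sklyanin0 sklyanin_origin.
Qed.

Lemma sov_sklyanin_unit :
  covec_mx (sov eta xi K k2 (sklyanin eta xi K k1 (@config_max N tws))) \in unitmx.
Proof.
rewrite (@covec_mx_scale _ _ _ (fun h : config => \prod_(n < N) coef_high tws eta xi k1 n (h n))
  _ (fun h => ladder tws eta xi K (label h))).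
- exact: ladder_mx_unit.
- by move=> h; apply/prodf_neq0 => n _; apply: (coef_high_neq0 eta0 adm K_unit detK); rewrite -ltnS.
- by move=> h; rewrite -sklyanin_sov sklyanin_ladder.
Qed.

End OffDiagonal.

Section Rotation.
Variables (K W : 'M[C]_2) (W_unit : W \in unitmx).
Local Notation K' := (invmx W *m K *m W).
Local Notation R := (rot tws W).

Lemma det_conj : \det K' = \det K.
Proof.
have W0 : \det W != 0 by rewrite -unitfE -unitmxE.
by rewrite !det_mulmx det_inv mulrAC mulVf // mul1r.
Qed.

Lemma closed_conj n : fus K' n (tws n).+1 0 = 0 -> fus K n (tws n).+1 0 = 0.
Proof. by move=> f0; rewrite -(fused_covariant tws eta xi W_unit) f0 mulmx0 mul0mx. Qed.

Lemma sov_rotated k2 (S : covec) (h : config) :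
  sov eta xi K k2 (S *m invmx R) h = sov eta xi K' k2 S h *m invmx R.
Proof.
have RU : R \in unitmx by apply: rot_unit.
rewrite !sovE // -!mulmxA; congr (_ *m _).
elim: (index_enum _) => [|n r IH]; first by rewrite !big_nil mulmx1 mul1mx.
rewrite !big_cons -!mulmxE -mulmxA -IH !mulmxA; congr (_ *m _).
rewrite -(fused_covariant tws eta xi W_unit) -!scalemxAl -scalemxAr !mulmxA mulVmx // mul1mx.
by rewrite scalemxAl.
Qed.

End Rotation.

Section General.
Variables (K : 'M[C]_2) (K_unit : K \in unitmx).
Variables (k1 k2 : C) (detK : \det K = k1 * k2).

Lemma conj_offdiag : ~~ is_scalar_mx K ->
  exists2 W : 'M[C]_2, W \in unitmx & (invmx W *m K *m W) 0 1 != 0.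
Proof.
move=> Ks; have [K01|] := eqVneq (K 0 1) 0; last first.
  by exists 1%:M; rewrite ?unitmx1 // invmx1 mul1mx mulmx1.
(* As K_01 = 0, conjugation by U x gives the entry x (K_00 - K_11 - x K_10). Were it zero at both x
   = 1 and x = -1, K would be scalar. *)
pose U (x : C) : 'M[C]_2 := mx2 1 x 0 1.
have UU x : U (- x) *m U x = 1%:M.
  apply/matrixP => i j; rewrite !mxE big_ord2 !mxE /=.
  case: (ord2_cases i) => ->; case: (ord2_cases j) => -> /=;
    by rewrite ?mulr0 ?mul0r ?mulr1 ?mul1r ?addr0 ?add0r ?subrr ?addrN.
have Uu x : U x \in unitmx by have [] := mulmx1_unit (UU x).
have Ui x : invmx (U x) = U (- x).
  by rewrite -[RHS]mulmx1 -(mulmxV (Uu x)) mulmxA UU mul1mx.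
have E x : (invmx (U x) *m K *m U x) 0 1 = x * (K 0 0 - K 1 1 - x * K 1 0).
  by rewrite Ui !mxE !big_ord2 !mxE !big_ord2 !mxE /= K01; ring.
have [E1|] := eqVneq (K 0 0 - K 1 1 - K 1 0) 0; last first.
  by move=> E1; exists (U 1); rewrite // E !mul1r.
exists (U (-1)); rewrite // E mulN1r oppr_eq0 mulN1r opprK.
apply: contra Ks => /eqP E2; apply/is_scalar_mxP; exists (K 0 0).
have K10 : K 1 0 = 0.
  have : 2 * K 1 0 = (K 0 0 - K 1 1 + K 1 0) - (K 0 0 - K 1 1 - K 1 0) by ring.
  by rewrite E1 E2 subrr => /eqP; rewrite mulf_eq0 pnatr_eq0 => /eqP.
have K11 : K 1 1 = K 0 0 by apply/esym/eqP; rewrite -subr_eq0 -E2 K10 addr0.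
apply/matrixP => i j; rewrite mxE.
by case: (ord2_cases i) => ->; case: (ord2_cases j) => -> /=; rewrite ?K01 ?K10 ?K11.
Qed.

Lemma fused_closed_general n : ~~ is_scalar_mx K -> fus K n (tws n).+1 0 = 0.
Proof.
move=> /conj_offdiag [W Wu K01]; apply: (closed_conj Wu).
apply: fused_closed => //; rewrite unitmxE det_conj // -unitmxE //.
Qed.

End General.

End SklyaninIdentification.

(** * Genericity *)

Section Polynomiality.

Variables (C : numClosedFieldType) (m : nat).
Local Notation fn := (('I_m -> C) -> C).

Definition poly_fun (f : fn) := exists p : {mpoly C[m]}, forall v, p.@[v] = f v.

Lemma poly_fun_cst c : poly_fun (fun=> c).
Proof. by exists (mpoly.mpolyC _ c) => v; rewrite mpoly.mevalC. Qed.

Lemma poly_fun_var k : poly_fun (fun v => v k).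
Proof. by exists ('X_k)%R => v; rewrite mpoly.mevalXU. Qed.

Lemma poly_funD f g : poly_fun f -> poly_fun g -> poly_fun (fun v => f v + g v).
Proof. by move=> [p pf] [q qg]; exists (p + q) => v; rewrite mpoly.mevalD pf qg. Qed.

Lemma poly_funM f g : poly_fun f -> poly_fun g -> poly_fun (fun v => f v * g v).
Proof. by move=> [p pf] [q qg]; exists (p * q) => v; rewrite mpoly.mevalM pf qg. Qed.

Lemma poly_fun_ext f g : (forall v, f v = g v) -> poly_fun f -> poly_fun g.
Proof. by move=> fg [p pf]; exists p => v; rewrite pf. Qed.

Lemma poly_funB f g : poly_fun f -> poly_fun g -> poly_fun (fun v => f v - g v).
Proof. by move=> [p pf] [q qg]; exists (p - q) => v; rewrite mpoly.mevalB pf qg. Qed.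

Lemma poly_fun_sum I (r : seq I) (F : I -> fn) :
  (forall i, poly_fun (F i)) -> poly_fun (fun v => \sum_(i <- r) F i v).
Proof.
move=> FP; elim: r => [|i r IH].
  by apply: poly_fun_ext (poly_fun_cst 0) => v; rewrite big_nil.
by apply: poly_fun_ext (poly_funD (FP i) IH) => v; rewrite big_cons.
Qed.

Lemma poly_fun_prod I (r : seq I) (F : I -> fn) :
  (forall i, poly_fun (F i)) -> poly_fun (fun v => \prod_(i <- r) F i v).
Proof.
move=> FP; elim: r => [|i r IH].
  by apply: poly_fun_ext (poly_fun_cst 1) => v; rewrite big_nil.
by apply: poly_fun_ext (poly_funM (FP i) IH) => v; rewrite big_cons.
Qed.

Definition poly_mx p q (F : ('I_m -> C) -> 'M[C]_(p, q)) :=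
  forall i j, poly_fun (fun v => F v i j).

Lemma poly_mx_cst p q (X : 'M[C]_(p, q)) : poly_mx (fun=> X).
Proof. by move=> i j; apply: poly_fun_cst. Qed.

Lemma poly_mxD p q (F G : ('I_m -> C) -> 'M[C]_(p, q)) :
  poly_mx F -> poly_mx G -> poly_mx (fun v => F v + G v).
Proof.
by move=> FP GP i j; apply: poly_fun_ext (poly_funD (FP i j) (GP i j)) => v; rewrite mxE.
Qed.

Lemma poly_mxZ p q (f : fn) (F : ('I_m -> C) -> 'M[C]_(p, q)) :
  poly_fun f -> poly_mx F -> poly_mx (fun v => f v *: F v).
Proof.
by move=> fP FP i j; apply: poly_fun_ext (poly_funM fP (FP i j)) => v; rewrite mxE.
Qed.

Lemma poly_mxM p q r (F : ('I_m -> C) -> 'M[C]_(p, q)) (G : ('I_m -> C) -> 'M[C]_(q, r)) :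
  poly_mx F -> poly_mx G -> poly_mx (fun v => F v *m G v).
Proof.
move=> FP GP i j.
apply: poly_fun_ext (poly_fun_sum (index_enum 'I_q)
  (F := fun k v => F v i k * G v k j) _) => [v|k]; first by rewrite mxE.
exact: poly_funM.
Qed.

Lemma poly_fun_det p (F : ('I_m -> C) -> 'M[C]_p) :
  poly_mx F -> poly_fun (fun v => \det (F v)).
Proof.
move=> FP; apply: poly_fun_sum => s; apply: poly_funM; first exact: poly_fun_cst.
by apply: poly_fun_prod => i; apply: FP.
Qed.

Variables (N : nat) (tws : 'I_N -> nat) (eta : C).
Local Notation config := (config tws).
Local Notation opH := 'M[C]_#|{: config}|.
Variables (xi : ('I_m -> C) -> 'I_N -> C) (xiP : forall n, poly_fun (fun v => xi v n)).
Variable K : 'M[C]_2.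

Lemma poly_mx_prod I (r : seq I) (F : I -> ('I_m -> C) -> opH) :
  (forall i, poly_mx (F i)) -> poly_mx (fun v => \prod_(i <- r) F i v).
Proof.
move=> FP; elim: r => [|i r IH] a b.
  by apply: poly_fun_ext (poly_mx_cst 1 a b) => v; rewrite big_nil.
by apply: poly_fun_ext (poly_mxM (FP i) IH a b) => v; rewrite big_cons mulmxE.
Qed.

Lemma poly_mx_lax n (lam : fn) i j : poly_fun lam ->
  poly_mx (fun v => lax tws eta n (lam v) i j).
Proof.
move=> lamP a b; apply: poly_fun_ext (poly_mxD
  (poly_mxZ (poly_funM (poly_fun_cst (i == j)%:R) lamP) (poly_mx_cst 1%:M))
  (poly_mx_cst (eta *: site (gl2_gen C (tws n) i j))) a b) => v.
by rewrite laxE local_laxE siteD siteZ site_scalar scalemx1.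
Qed.

Lemma poly_mx_monodromy (lam : fn) i j : poly_fun lam ->
  poly_mx (fun v => monodromy tws eta (xi v) K (lam v) i j).
Proof.
move=> lamP.
have lP n a b : poly_mx (fun v => lax tws eta n (lam v - xi v n) a b).
  exact: poly_mx_lax (poly_funB lamP (xiP n)).
have prodP (r : seq 'I_N) a b : poly_mx (fun v =>
    (\prod_(n <- r) lax tws eta (rev_ord n) (lam v - xi v (rev_ord n))) a b).
  elim: r a b => [|n r IH] a b k l.
    apply: poly_fun_ext (poly_mx_cst ((1%:M : 'M[opH]_2) a b) k l) => v.
    by rewrite big_nil.
  apply: poly_fun_ext (poly_mxD (poly_mxM (lP (rev_ord n) a 0) (IH 0 b))
    (poly_mxM (lP (rev_ord n) a 1) (IH 1 b)) k l) => v.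
  by rewrite big_cons [in RHS]mxE big_ord2 -!mulmxE.
move=> k l.
apply: poly_fun_ext (poly_mxD
  (poly_mxM (poly_mx_cst (lift_op tws K i 0)) (prodP (index_enum 'I_N) 0 j))
  (poly_mxM (poly_mx_cst (lift_op tws K i 1)) (prodP (index_enum 'I_N) 1 j)) k l) => v.
by rewrite /monodromy [in RHS]mxE big_ord2 -!mulmxE.
Qed.

Lemma poly_fun_xik n k : poly_fun (fun v => xik tws eta (xi v) n k).
Proof.
apply: poly_fun_ext (poly_funD (xiP n)
  (poly_fun_cst (- (eta / 2) + ((tws n)%:R / 2 - k%:R) * eta))) => v.
by rewrite addrA.
Qed.

Lemma poly_fun_qdet (lam : fn) : poly_fun lam ->
  poly_fun (fun v => qdet_at tws eta (xi v) K (lam v)).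
Proof.
move=> lamP.
apply: poly_funM; first exact: poly_fun_cst.
apply: poly_funM; apply: poly_fun_prod => n; apply: poly_funB (poly_fun_xik _ _) => //.
exact: poly_funB lamP (poly_fun_cst _).
Qed.

Lemma poly_mx_fused (x : fn) l k : poly_fun x ->
  poly_mx (fun v => fused tws eta (xi v) K (x v) l k).
Proof.
move=> xP.
have sP j : poly_fun (fun v => x v - j%:R * eta).
  exact: poly_funB xP (poly_fun_cst _).
have tP j : poly_mx (fun v => transfer1 tws eta (xi v) K (x v - j%:R * eta)).
  move=> a b; apply: poly_fun_ext (poly_mxD (poly_mx_monodromy 0 0 (sP j))
    (poly_mx_monodromy 1 1 (sP j)) a b) => v.
  by rewrite /transfer1 /mxtrace big_ord2.
suff: forall k, poly_mx (fun v => fused tws eta (xi v) K (x v) l k) /\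
    poly_mx (fun v => fused tws eta (xi v) K (x v) l.+1 k) by move/(_ k) => [].
elim: l {k} => [|l IH] k.
  by split; [apply: poly_mx_cst | apply: tP].
have [E0 E1] := IH k; split=> // a b.
have qP : poly_fun (fun v => - qdet_at tws eta (xi v) K (x v - (k + l)%:R * eta)).
  apply: poly_fun_ext (poly_funB (poly_fun_cst 0) (poly_fun_qdet (sP (k + l)%N))) => v.
  by rewrite sub0r.
apply: poly_fun_ext (poly_mxD (poly_mxM E1 (tP (k + l.+1)%N)) (poly_mxZ qP E0) a b) => v.
by rewrite fused_recr scaleNr.
Qed.

End Polynomiality.

Section AdmissiblePoint.

Variables (C : numClosedFieldType) (N : nat) (tws : 'I_N -> nat).
Variables (eta : C) (eta0 : eta != 0).

(* The gaps are nonzero multiples of eta / (2 N) of size less than eta / 2,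
   whereas the spins shift them by multiples of eta / 2. *)
Lemma admissible_exists : admissible tws eta (fun i => eta * (i%:R / (2 * N%:R))).
Proof.
move=> i j ij z.
have N0 : (N%:R : C) != 0.
  by rewrite pnatr_eq0; case: (N) i {j ij} => [[]|].
have key (s : int) : eta * (i%:R / (2 * N%:R)) - eta * (j%:R / (2 * N%:R)) + s%:~R / 2 * eta
    != eta *~ z.
  apply/eqP => E.
  have: ((i%:Z - j%:Z) + N%:Z * s)%:~R = (2 * N%:Z * z)%:~R :> C.
    apply: (mulfI eta0); rewrite !rmorphD !rmorphM rmorphN /= -!pmulrn.
    transitivity (2 * N%:R *
        (eta * (i%:R / (2 * N%:R)) - eta * (j%:R / (2 * N%:R)) + s%:~R / 2 * eta)).
      by field; rewrite N0.
    by rewrite E -mulrzr; ring.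
  move/intr_inj => E'.
  have iN := ltn_ord i; have jN := ltn_ord j; have ij' : (i != j :> nat) by [].
  have {}E' : i%:Z - j%:Z = N%:Z * (2 * z - s) by rewrite mulrBr mulrA [N%:Z * 2]mulrC -E' addrK.
  move: (2 * z - s) E' => w E'.
  have [w0|w0|w0] := ltrgtP w 0; [nia | nia | rewrite w0 mulr0 in E'; lia].
split; first by have := key 0; rewrite mul0r mul0r addr0.
have := key ((tws i)%:Z - (tws j)%:Z); rewrite intrB -!pmulrn; congr (_ != _).
by rewrite /xik; field; rewrite N0.
Qed.

End AdmissiblePoint.

(** * The generic basis *)

Section GenericBasis.

Variables (C : numClosedFieldType) (N : nat) (tws : 'I_N -> nat).
Variables (eta : C) (eta0 : eta != 0).
Local Notation config := (config tws).
Local Notation D := #|{: config}|.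
Local Notation covec := 'rV[C]_D.
Variables (K : 'M[C]_2) (K_unit : K \in unitmx).
Variables (k1 k2 : C) (detK : \det K = k1 * k2).

Lemma covec_mxM (v : config -> covec) (X : 'M[C]_D) :
  covec_mx (fun h => v h *m X) = covec_mx v *m X.
Proof. by apply/row_matrixP => i; rewrite row_mul !rowK. Qed.

Lemma sov_rotated_unit (xi : 'I_N -> C) (W : 'M[C]_2) : admissible tws eta xi ->
  W \in unitmx -> (invmx W *m K *m W) 0 1 != 0 ->
  covec_mx (sov eta xi K k2 (sklyanin_rot eta xi K W k1 (@config_max N tws))) \in unitmx.
Proof.
move=> adm Wu K01; set K' := invmx W *m K *m W.
have K'u : K' \in unitmx by rewrite unitmxE det_conj // -unitmxE.
have dK' : \det K' = k1 * k2 by rewrite det_conj.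
have -> : covec_mx (sov eta xi K k2 (sklyanin_rot eta xi K W k1 (@config_max N tws))) =
    covec_mx (sov eta xi K' k2 (sklyanin eta xi K' k1 (@config_max N tws))) *m
    invmx (rot tws W).
  rewrite -covec_mxM; apply/row_matrixP => i; rewrite !rowK.
  exact: sov_rotated.
by rewrite unitmx_mul sov_sklyanin_unit // unitmx_inv rot_unit.
Qed.

(** Dropping the scalar factors, which contain 1/d, leaves entries polynomial in S and xi; at
    admissible points these factors are nonzero and only rescale the covectors. *)
Definition sov_numerator (xi : 'I_N -> C) (S : covec) (h : config) : covec :=
  S *m \prod_(n < N) fused tws eta xi K (xik tws eta xi n 0) (tws n - h n) (h n).+1.

Lemma sov_unit_numerator xi S : admissible tws eta xi ->
  (covec_mx (sov eta xi K k2 S) \in unitmx) = (\det (covec_mx (sov_numerator xi S)) != 0).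
Proof.
move=> adm; rewrite -unitfE -unitmxE.
apply: (@covec_mx_scale _ _ _ (fun h => \prod_(n < N) coef_low tws eta xi k2 n (h n))).
  by move=> h; apply/prodf_neq0 => n _; apply: (coef_low_neq0 eta0 adm K_unit detK).
by move=> h; rewrite sovE // prod_scale_mx -scalemxAr.
Qed.

Lemma sov_generic_basis : ~~ is_scalar_mx K ->
  exists2 p : {mpoly C[D + N]}, p != 0 &
    forall (S : covec) (xi : 'I_N -> C), admissible tws eta xi ->
      p.@[fun k => row_mx S (\row_n xi n) 0 k] != 0 ->
      is_covec_basis (sov eta xi K k2 S).
Proof.
move=> Ks.
pose Sv (v : 'I_(D + N) -> C) : covec := \row_j v (lshift N j).
pose xv (v : 'I_(D + N) -> C) (n : 'I_N) := v (rshift D n).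
have xP n : poly_fun (fun v => xv v n) by exact: poly_fun_var.
have [p pE] : poly_fun (fun v => \det (covec_mx (sov_numerator (xv v) (Sv v)))).
  apply: poly_fun_det => i j.
  have SP : poly_mx Sv.
    move=> a b; apply: (@poly_fun_ext _ _ (fun v => v (lshift N b))) => [v|].
      by rewrite mxE.
    exact: poly_fun_var.
  have FP n : poly_mx (fun v => fused tws eta (xv v) K (xik tws eta (xv v) n 0)
      (tws n - (enum_val i : config) n) ((enum_val i : config) n).+1).
    by apply: poly_mx_fused => //; apply: poly_fun_xik.
  apply: poly_fun_ext (poly_mxM SP (poly_mx_prod (index_enum 'I_N) FP) 0 j) => v.
  by rewrite [RHS]mxE.
have pS S xi : p.@[fun k => row_mx S (\row_n xi n) 0 k] = \det (covec_mx (sov_numerator xi S)).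
  have xvE : xv (fun k => row_mx S (\row_n xi n) 0 k) = xi.
    by apply: boolp.funext => n; rewrite /xv row_mxEr mxE.
  have SvE : Sv (fun k => row_mx S (\row_n xi n) 0 k) = S.
    by apply/rowP => j; rewrite mxE row_mxEl.
  by rewrite pE xvE SvE.
exists p.
  (* The point where p does not vanish: the explicit admissible inhomogeneities, with the rotated
     Sklyanin covector of top label as S. *)
  have [W Wu K01] := conj_offdiag Ks.
  have adm := admissible_exists tws eta0.
  have := sov_rotated_unit adm Wu K01.
  rewrite sov_unit_numerator // -pS; apply: contra_neq => ->.
  exact: mpoly.meval0.
move=> S xi adm; rewrite pS -sov_unit_numerator //.
exact: covec_mx_basis.
Qed.

End GenericBasis.

Theorem theorem4p2 (R : realType) (eta : R[i]) (eta_neq0 : eta != 0)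
    (N : nat) (N_gt0 : (0 < N)%N)
    (tws : 'I_N -> nat) (tws_gt0 : forall n, (0 < tws n)%N)
    (K : 'M[R[i]]_2) (K_unit : K \in unitmx) (K_nscalar : ~~ is_scalar_mx K)
    (k1 k2 : R[i])
    (K_eigen : char_poly K = ('X - k1%:P) * ('X - k2%:P)) :
  [/\ exists2 p : {mpoly R[i][#|{: config tws}| + N]}, p != 0 &
        forall (S : 'rV[R[i]]_#|{: config tws}|) (xi : 'I_N -> R[i]),
          admissible tws eta xi ->
          p.@[fun k => row_mx S (\row_n xi n) 0 k] != 0 ->
          is_covec_basis (sov eta xi K k2 S),
      forall (S : 'rV[R[i]]_#|{: config tws}|) (xi : 'I_N -> R[i]),
        admissible tws eta xi ->
        forall h : config tws,
          sov eta xi K k2 S h =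
          sov_from_origin eta xi K k1 (sov eta xi K k2 S config0) h,
      K 0 1 != 0 ->
        forall xi : 'I_N -> R[i], admissible tws eta xi ->
        let S := sklyanin eta xi K k1 config_max in
        [/\ is_covec_basis (sov eta xi K k2 S),
            sov eta xi K k2 S config0 = bra0 &
            forall h : config tws,
              sklyanin eta xi K k1 h = sov eta xi K k2 S h] &
      K 0 1 = 0 ->
        forall (W : 'M[R[i]]_2), W \in unitmx ->
        (invmx W *m K *m W) 0 1 != 0 -> (invmx W *m K *m W) 1 0 != 0 ->
        forall xi : 'I_N -> R[i], admissible tws eta xi ->
        let S := sklyanin_rot eta xi K W k1 config_max in
        is_covec_basis (sov eta xi K k2 S) /\
        forall h : config tws,
          sklyanin_rot eta xi K W k1 h = sov eta xi K k2 S h].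
Proof.
(* Constant coefficients of the characteristic polynomial; the sign is (-1)^2. *)
have detK : \det K = k1 * k2.
  have := char_poly_det K; rewrite K_eigen -horner_coef0 hornerM !hornerXsubC !sub0r.
  by rewrite mulrNN expr2 mulrNN !mul1r => ->.
split.
- exact: sov_generic_basis detK K_nscalar.
- move=> S xi adm h; apply: (sov_sov_from_origin eta_neq0 adm K_unit detK) => n.
  exact: fused_closed_general.
- move=> K01 xi adm S; split.
  + by apply: covec_mx_basis; apply: (sov_sklyanin_unit eta_neq0 adm K_unit K01 detK).
  + exact: (sov_sklyanin0 eta_neq0 adm K_unit K01 detK).
  + exact: (sklyanin_sov eta_neq0 adm K_unit K01 detK).
- move=> _ W Wu K01 _ xi adm S.
  split; first by apply: covec_mx_basis; apply: (sov_rotated_unit eta_neq0 K_unit detK adm Wu K01).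
  have K'u : invmx W *m K *m W \in unitmx by rewrite unitmxE det_conj // -unitmxE.
  move=> h; rewrite /S /sklyanin_rot.
  rewrite (sklyanin_sov eta_neq0 adm K'u K01 (etrans (det_conj K Wu) detK)).
  by rewrite -(sov_rotated eta_neq0).
Qed.
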